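(* If $A$ is a $C^*$-algebra then $V_A=V_A^1\cup V_A^2$.
   Context: $A$ is not assumed unital. ''Ideal'' means closed two-sided ideal; $Z(A)$ is the centre of $A$. An element $a\in A$ is a CQ-element of $A$ if for every ideal $I$ of $A$, $a+I\in Z(A/I)$ implies $a\in Z(A)+I$. $\mathrm{CQ}(A)$ is the set of all CQ-elements of $A$, and $V_A:=A\setminus\mathrm{CQ}(A)$. An ideal $I$ is modular if $A/I$ is unital; $\mathrm{Max}(A)$ is the set of all modular maximal (proper) ideals of $A$. $V_A^1$ is the set of all $a\in A$ for which there exists $M\in\mathrm{Max}(A)$ such that $Z(A)\subseteq M$ and $a+M$ is a non-zero scalar (multiple of the identity) in $A/M$. $V_A^2$ is the set of all $a\in A$ for which there exist $M_1,M_2\in\mathrm{Max}(A)$ and scalars $\lambda_1\neq\lambda_2$ in $\mathbb{C}$ such that $Z(A)\nsubseteq M_i$ $(i=1,2)$, $M_1\cap Z(A)=M_2\cap Z(A)$ and $a+M_i=\lambda_i 1_{A/M_i}$ $(i=1,2)$. *)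

(* Defs.v *)
From HB Require Import structures.
From mathcomp Require Import all_boot all_order all_algebra.
From mathcomp Require Import complex.
From mathcomp Require Import all_classical all_reals all_analysis.

Set Implicit Arguments.
Unset Strict Implicit.
Unset Printing Implicit Defensive.

Import Order.TTheory GRing.Theory Num.Theory.
Import numFieldNormedType.Exports.

Local Open Scope classical_set_scope.
Local Open Scope ring_scope.
Local Open Scope complex_scope.
Local Open Scope quotient_scope.

(* Associative algebras with no unit assumed; MathComp's ring and algebra
   structures all carry a 1. *)
HB.mixin Record Lmodule_isNonUnitalAlgebra (K : fieldType) A
    of GRing.Lmodule K A := {
  amul : A -> A -> A;
  amulA : associative amul;
  amulDl : left_distributive amul +%R;
  amulDr : right_distributive amul +%R;
  amulZl : forall (k : K) (x y : A), amul (k *: x) y = k *: amul x y;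
  amulZr : forall (k : K) (x y : A), amul x (k *: y) = k *: amul x y
}.

#[short(type="nonUnitalAlgType")]
HB.structure Definition NonUnitalAlgebra (K : fieldType) :=
  {A of GRing.Lmodule K A & Lmodule_isNonUnitalAlgebra K A}.

Local Notation "x ** y" := (amul x y) (at level 40, left associativity).

Section NonUnitalAlgebraDefs.
Variables (K : fieldType) (B : nonUnitalAlgType K).

Definition centre : set B := [set z | forall x : B, z ** x = x ** z].

Definition is_identity (e : B) : Prop :=
  forall x : B, e ** x = x /\ x ** e = x.

Definition unital : Prop := exists e : B, is_identity e.

Lemma amulBl (x y z : B) : (x - y) ** z = x ** z - y ** z.
Proof. by rewrite -[- y]scaleN1r amulDl amulZl scaleN1r. Qed.

Lemma amulBr (x y z : B) : x ** (y - z) = x ** y - x ** z.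
Proof. by rewrite -[- z]scaleN1r amulDr amulZr scaleN1r. Qed.

End NonUnitalAlgebraDefs.

Arguments centre {K} B.
Arguments unital {K} B.

(* The norm takes its (real, nonnegative) values in R[i], as for every
   normedModType over R[i]. *)
HB.mixin Record isCStarAlgebra (R : realType) A
    of CompleteNormedModule R[i] A & NonUnitalAlgebra R[i] A := {
  normM_le : forall x y : A, `|x ** y| <= `|x| * `|y|;
  cstar : A -> A;
  cstarK : involutive cstar;
  cstarD : {morph cstar : x y / x + y};
  cstarZ : forall (k : R[i]) (x : A), cstar (k *: x) = Num.conj k *: cstar x;
  cstarM : forall x y : A, cstar (x ** y) = cstar y ** cstar x;
  cstar_norm : forall x : A, `|cstar x ** x| = `|x| ^+ 2
}.

#[short(type="cstarAlgType")]
HB.structure Definition CStarAlgebra (R : realType) :=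
  {A of CompleteNormedModule R[i] A & NonUnitalAlgebra R[i] A
      & isCStarAlgebra R A}.

Record ideal (R : realType) (A : cstarAlgType R) := Ideal {
  ideal_set :> set A;
  ideal0 : ideal_set 0;
  idealD : forall x y, ideal_set x -> ideal_set y -> ideal_set (x + y);
  idealZ : forall (k : R[i]) x, ideal_set x -> ideal_set (k *: x);
  idealMl : forall x y, ideal_set y -> ideal_set (x ** y);
  idealMr : forall x y, ideal_set x -> ideal_set (x ** y);
  ideal_closed : closed ideal_set
}.

Definition ideal_pred (R : realType) (A : cstarAlgType R) (I : ideal A)
  : A -> bool := fun x => `[< ideal_set I x >].

Section IdealQuotient.
Variables (R : realType) (A : cstarAlgType R) (I : ideal A).

Lemma ideal_zmod_closed : zmod_closed (ideal_pred I).
Proof.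
split=> [|x y /asboolP Ix /asboolP Iy]; apply/asboolP; first exact: ideal0.
by rewrite -scaleN1r; apply: idealD => //; apply: idealZ.
Qed.

HB.instance Definition _ :=
  GRing.isZmodClosed.Build A (ideal_pred I) ideal_zmod_closed.

Definition quotient : Type :=
  @Quotient.quot A (GRing.ZmodClosed.clone A (ideal_pred I) _).

HB.instance Definition _ := GRing.Zmodule.on quotient.
HB.instance Definition _ := EqQuotient.on quotient.

(* the coset a + I *)
Definition coset (a : A) : quotient := \pi_quotient a.

Lemma coset_surj (u : quotient) : exists a, coset a = u.
Proof. by exists (repr u); exact: reprK. Qed.

Lemma cosetP (x y : A) : coset x = coset y <-> ideal_set I (x - y).
Proof.
split=> [/eqP|Ixy]; last apply/eqP; rewrite -[_ == _]Quotient.idealrBE.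
  by move/asboolP.
exact/asboolP.
Qed.

Lemma cosetD (x y : A) : coset (x + y) = coset x + coset y.
Proof. exact: Quotient.pi_add. Qed.

Definition quotient_scale (k : R[i]) (u : quotient) : quotient :=
  coset (k *: repr u).

Definition quotient_mul (u v : quotient) : quotient :=
  coset (repr u ** repr v).

Lemma repr_coset (x : A) : ideal_set I (repr (coset x) - x).
Proof. by apply/cosetP; exact: reprK. Qed.

Lemma cosetZ (k : R[i]) (x : A) : coset (k *: x) = quotient_scale k (coset x).
Proof.
apply/esym/cosetP; rewrite -scalerBr; apply: idealZ; exact: repr_coset.
Qed.

Lemma cosetM (x y : A) : coset (x ** y) = quotient_mul (coset x) (coset y).
Proof.
apply/esym/cosetP; set x' := repr _; set y' := repr _.
have -> : x' ** y' - x ** y = (x' - x) ** y' + x ** (y' - y).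
  by rewrite amulBl amulBr addrA subrK.
by apply: idealD; [apply: idealMr|apply: idealMl]; exact: repr_coset.
Qed.

Let scaleA (k l : R[i]) (u : quotient) :
  quotient_scale k (quotient_scale l u) = quotient_scale (k * l) u.
Proof. by have [x <-] := coset_surj u; rewrite -!cosetZ scalerA. Qed.

Let scale1 : left_id 1 quotient_scale.
Proof. by move=> u; have [x <-] := coset_surj u; rewrite -cosetZ scale1r. Qed.

Let scaleDr : right_distributive quotient_scale +%R.
Proof.
move=> k u v; have [x <-] := coset_surj u; have [y <-] := coset_surj v.
by rewrite -cosetD -!cosetZ -cosetD scalerDr.
Qed.

Let scaleDl (u : quotient) : {morph quotient_scale^~ u : k l / k + l}.
Proof.
by move=> k l; have [x <-] := coset_surj u; rewrite -!cosetZ -cosetD scalerDl.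
Qed.

HB.instance Definition _ := GRing.Zmodule_isLmodule.Build R[i] quotient
  scaleA scale1 scaleDr scaleDl.

Let mulA : associative quotient_mul.
Proof.
move=> u v w; have [x <-] := coset_surj u; have [y <-] := coset_surj v.
by have [z <-] := coset_surj w; rewrite -!cosetM amulA.
Qed.

Let mulDl : left_distributive quotient_mul +%R.
Proof.
move=> u v w; have [x <-] := coset_surj u; have [y <-] := coset_surj v.
by have [z <-] := coset_surj w; rewrite -cosetD -!cosetM -cosetD amulDl.
Qed.

Let mulDr : right_distributive quotient_mul +%R.
Proof.
move=> u v w; have [x <-] := coset_surj u; have [y <-] := coset_surj v.
by have [z <-] := coset_surj w; rewrite -cosetD -!cosetM -cosetD amulDr.
Qed.

Let mulZl (k : R[i]) (u v : quotient) :
  quotient_mul (k *: u) v = k *: quotient_mul u v.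
Proof.
have [x <-] := coset_surj u; have [y <-] := coset_surj v.
have E z : k *: coset z = coset (k *: z) by rewrite cosetZ.
by rewrite E -!cosetM E amulZl.
Qed.

Let mulZr (k : R[i]) (u v : quotient) :
  quotient_mul u (k *: v) = k *: quotient_mul u v.
Proof.
have [x <-] := coset_surj u; have [y <-] := coset_surj v.
have E z : k *: coset z = coset (k *: z) by rewrite cosetZ.
by rewrite E -!cosetM E amulZr.
Qed.

HB.instance Definition _ := Lmodule_isNonUnitalAlgebra.Build R[i] quotient
  mulA mulDl mulDr mulZl mulZr.

End IdealQuotient.

Section CQ.
Variables (R : realType) (A : cstarAlgType R).

Definition is_CQ (a : A) : Prop :=
  forall I : ideal A, centre (quotient I) (coset I a) ->
    [set z + x | z in centre A & x in I] a.

Definition CQ : set A := [set a | is_CQ a].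

Definition V : set A := ~` CQ.

Definition ideal_modular (I : ideal A) : Prop := unital (quotient I).

Definition ideal_proper (I : ideal A) : Prop := I <> setT :> set A.

Definition ideal_maximal (I : ideal A) : Prop :=
  ideal_proper I /\
  forall J : ideal A, ideal_proper J -> I `<=` J -> J = I :> set A.

Definition Max : set (ideal A) := [set M | ideal_modular M /\ ideal_maximal M].

(* a + I = k 1_{A/I} *)
Definition scalar_mod (I : ideal A) (a : A) (k : R[i]) : Prop :=
  exists e : quotient I, is_identity e /\ coset I a = k *: e.

Definition V1 : set A := [set a | exists M : ideal A,
  [/\ Max M, centre A `<=` M &
      exists k : R[i], k != 0 /\ scalar_mod M a k]].

Definition V2 : set A := [set a | exists (M1 M2 : ideal A) (k1 k2 : R[i]),
  [/\ Max M1 /\ Max M2,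
      k1 != k2,
      ~ (centre A `<=` M1) /\ ~ (centre A `<=` M2),
      M1 `&` centre A = M2 `&` centre A &
      scalar_mod M1 a k1 /\ scalar_mod M2 a k2]].

End CQ.

Arguments CQ {R} A.
Arguments V {R} A.
Arguments V1 {R} A.
Arguments V2 {R} A.

(* Main.v *)
(* The easy inclusion is a computation modulo [M], respectively modulo the
   intersection of [M1] and [M2].  For the other one, let [a] be central modulo
   [I] but not in [Z(A) + I].  Among the ideals [J] containing [I] and such that
   [a] stays at distance at least [d] from [W + J], where [W] is a ball of
   [Z(A)], take a maximal one.  As in Machado's proof of the Stone-Weierstrass
   theorem, maximality forces every selfadjoint [s] in [Z(A)] to be scalar
   modulo [J]: otherwise the ideals of elements supported on either side of some
   point of the spectrum of [s] are strictly larger than [J], and approximants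
   of [a] modulo these two ideals can be glued along an approximate spectral
   cutoff of [s].  Applied with [W = 0], the same argument shows that an element
   central modulo [J] and outside [J] is a non-zero scalar modulo some modular
   maximal ideal containing [J]; applied to [a], or to the identity [e] modulo
   [J] and then to [a - k e], this yields the ideals required by [V1] or [V2].
   The functional calculus reduces to the bound of [p(s)] by the supremum of
   [|p|], obtained from Bernstein polynomials. *)

From mathcomp Require Import all_boot all_order all_algebra all_solvable all_field ring lra zify.
From mathcomp Require Import complex.
From mathcomp Require Import all_classical all_reals all_analysis.
Require Import Defs.

Set Implicit Arguments.
Unset Strict Implicit.
Unset Printing Implicit Defensive.

Import Order.TTheory GRing.Theory Num.Theory.
Import numFieldNormedType.Exports.

Local Open Scope classical_set_scope.
Local Open Scope ring_scope.

Local Notation "x ** y" := (amul x y) (at level 40, left associativity).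

(** * Norms *)

(** Two obstacles shape the argument. Without a unit, functions of [s] need not be elements of [A]:
    polynomials act on [A] as operators, and spectral information modulo [J] is expressed by
    distances such as [dist J (ract H p x)]. Moreover the constants must be sharp, since a gluing
    bound [2 * d] in place of [d] would not contradict maximality. Sharpness comes from one device,
    used both for the supremum bound and for gluing: by the C*-identity norms at least square when a
    selfadjoint operator or element is squared, so an estimate of the [2^r]-th power that is off by
    a factor linear in [2^r] becomes exact. [W] is a ball of [Z(A)], not all of it, because
    approximation by [Z(A) + I] alone would only give membership in the closure. Central
    approximants of [b] whose norm is at most that of [b] make the successive corrections summable,
    hence give membership itself. Whether [V1] or [V2] occurs depends on whether [J] contains
    [Z(A)]; if not, some central element is an identity modulo [J]. *)

Section Norm.
Variables (R : realType) (V : normedModType R[i]).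
Implicit Types x y : V.

Definition rn x : R := complex.Re `|x|.

Lemma rnE x : `|x| = (rn x)%:C%C.
Proof.
by rewrite /rn RRe_real // ger0_real.
Qed.

Lemma rn_ge0 x : 0 <= rn x.
Proof. by rewrite -ler0c -rnE. Qed.

Lemma rn0 : rn 0 = 0.
Proof. by rewrite /rn normr0. Qed.

Lemma rn_eq0 x : rn x = 0 -> x = 0.
Proof. by move=> h; apply/eqP; rewrite -normr_eq0 rnE h. Qed.

Lemma rnD x y : rn (x + y) <= rn x + rn y.
Proof. by rewrite -lecR rmorphD /= -!rnE ler_normD. Qed.

Lemma rnN x : rn (- x) = rn x.
Proof. by rewrite /rn normrN. Qed.

Lemma rnB x y : rn (x - y) <= rn x + rn y.
Proof. by rewrite -(rnN y) rnD. Qed.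

Lemma rnZ (k : R[i]) x : rn (k *: x) = complex.Re `|k| * rn x.
Proof.
apply: complexI; rewrite rmorphM /= -!rnE normrZ.
by congr (_ * _); rewrite RRe_real // ger0_real.
Qed.

Lemma Re_normC (r : R) : complex.Re `|r%:C%C : R[i]| = `|r|.
Proof. by rewrite normc_def /= expr0n addr0 sqrtr_sqr. Qed.

Lemma rnZr (r : R) x : rn (r%:C%C *: x) = `|r| * rn x.
Proof. by rewrite rnZ Re_normC. Qed.

Lemma Re_norm1 (k : R[i]) : `|k| = 1 -> complex.Re `|k| = 1.
Proof. by move=> ->. Qed.

Lemma rn_sum (I : Type) (r : seq I) (P : pred I) (F : I -> V) :
  rn (\sum_(i <- r | P i) F i) <= \sum_(i <- r | P i) rn (F i).
Proof.
elim/big_ind2: _ => [|x a y b xa yb|//]; first by rewrite rn0.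
by rewrite (le_trans (rnD _ _))// lerD.
Qed.

Lemma closed_rnP (S : set V) :
  closed S <-> forall x, (forall e : R, 0 < e -> exists2 y, S y & rn (x - y) < e) -> S x.
Proof.
split=> [cS x hx|h].
  apply: cS => B /nbhs_ballP[e e0 eB].
  have e0' : 0 < complex.Re e by move: e0; rewrite /= ltcE => /andP[].
  have eE : e = (complex.Re e)%:C%C by rewrite RRe_real // gtr0_real.
  have [y Sy xy] := hx _ e0'; exists y; split => //; apply: eB.
  by rewrite -ball_normE /= eE rnE ltcR.
move=> x cx; apply: h => e e0.
have [|y [Sy By]] := cx (ball x e%:C%C); first by apply: nbhsx_ballx; rewrite ltcR.
by exists y => //; move: By; rewrite -ball_normE /= rnE ltcR.
Qed.

End Norm.

(** The limit inherits the modulus [e], so that later limits come with explicit error bounds. *)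
Lemma complete_rn (R : realType) (V : completeNormedModType R[i])
    (u : nat -> V) (e : nat -> R) :
  (forall m n, (m <= n)%N -> rn (u n - u m) <= e m) ->
  (forall eps, 0 < eps -> exists n, e n < eps) ->
  exists y, forall n, rn (y - u n) <= e n.
Proof.
move=> ue e0.
have uc : cvg (u @ \oo).
  apply/cauchy_cvgP/cauchy_ballP => eps eps0.
  have e0' : 0 < complex.Re eps by move: eps0; rewrite /= ltcE => /andP[].
  have eE : eps = (complex.Re eps)%:C%C by rewrite RRe_real // gtr0_real.
  have [N HN] := e0 _ (divr_gt0 e0' (ltr0n _ 2)).
  have xN n : (N <= n)%N -> rn (u n - u N) < complex.Re eps / 2.
    by move=> Nn; apply: le_lt_trans (ue _ _ Nn) HN.
  have [NN NNu HNN] : exists2 U, nbhs (u @ \oo) U & forall x, U x -> rn (x - u N) < complex.Re eps / 2.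
    exists [set x | rn (x - u N) < complex.Re eps / 2] => //.
    by exists N => // n /=; exact: xN.
  exists (NN, NN) => //= -[x y] /= [/HNN Hx /HNN Hy].
  rewrite -ball_normE /= eE rnE ltcR.
  have -> : x - y = (x - u N) - (y - u N) by rewrite opprB addrA subrK.
  apply: le_lt_trans (rnB _ _) _; rewrite (splitr (complex.Re eps)).
  exact: ltrD.
exists (lim (u @ \oo)) => n.
apply/ler_addgt0Pr => d d0.
have d0' : 0 < d%:C%C :> R[i] by rewrite ltcR.
have [N _ HN] := @cvgr_dist_lt _ _ _ _ _ _ _ uc _ d0'.
pose m := maxn n N.
have := HN m (leq_maxr _ _); rewrite /= rnE ltcR => Hm.
have -> : lim (u @ \oo) - u n = (u m - u n) + (lim (u @ \oo) - u m).
  by rewrite [RHS]addrC addrA subrK.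
apply: le_trans (rnD _ _) _; apply: lerD; last exact: ltW.
by apply: ue; exact: leq_maxl.
Qed.

(** * Consequences of the C*-identity *)

Section Algebra.
Variables (R : realType) (A : cstarAlgType R).
Implicit Types x y z : A.

Lemma amul0l y : 0 ** y = 0 :> A.
Proof. by rewrite -(scale0r (0 : A)) amulZl !scale0r. Qed.

Lemma amul0r y : y ** 0 = 0 :> A.
Proof. by rewrite -(scale0r (0 : A)) amulZr !scale0r. Qed.

Lemma rnM x y : rn (x ** y) <= rn x * rn y.
Proof. by have := normM_le x y; rewrite !rnE -rmorphM /= lecR. Qed.

Lemma rn_cstarM x : rn (cstar x ** x) = rn x ^+ 2.
Proof.
by have := cstar_norm x; rewrite !rnE -rmorphXn /= => /complexI.
Qed.

Lemma rn_cstar x : rn (cstar x) = rn x.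
Proof.
have le y : rn y <= rn (cstar y).
  have [->|y0] := eqVneq (rn y) 0; first exact: rn_ge0.
  have yp : 0 < rn y by rewrite lt_neqAle eq_sym y0 rn_ge0.
  by rewrite -(ler_pM2r yp) -expr2 -rn_cstarM rnM.
by apply/eqP; rewrite eq_le le -{2}(cstarK x) le.
Qed.

Lemma rn_mulcstar x : rn (x ** cstar x) = rn x ^+ 2.
Proof. by rewrite -{1}(cstarK x) rn_cstarM rn_cstar. Qed.

Lemma cstar0 : cstar 0 = 0 :> A.
Proof. by apply: rn_eq0; rewrite rn_cstar rn0. Qed.

Lemma cstarN x : cstar (- x) = - cstar x.
Proof. by apply/eqP; rewrite -subr_eq0 opprK -cstarD addNr cstar0. Qed.

Lemma cstarB x y : cstar (x - y) = cstar x - cstar y.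
Proof. by rewrite cstarD cstarN. Qed.

End Algebra.

(** * Polynomials in a positive contraction *)

(* A selfadjoint operator on [A] with spectrum in [[0, 1]] that acts like a
   multiplier: the cases of interest are the maps [x |-> (x + s ** x) / 2], so
   that no unitization of [A] is needed. *)
Record posop (R : realType) (A : cstarAlgType R) := Posop {
  op :> A -> A;
  opD : forall x y, op (x + y) = op x + op y;
  opZ : forall k x, op (k *: x) = k *: op x;
  opM : forall x y, op (x ** y) = op x ** y;
  op_sa : forall x y, cstar (op x) ** y = cstar x ** op y;
  op_contr : forall x, rn (2%:R *: op x - x) <= rn x
}.

Section Act.
Variables (R : realType) (A : cstarAlgType R) (H : posop A).
Implicit Types (x y : A) (p q : {poly R[i]}).

Definition act p x : A := \sum_(i < size p) p`_i *: iter i H x.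

Lemma act_wide n p x : (size p <= n)%N ->
  act p x = \sum_(i < n) p`_i *: iter i H x.
Proof.
move=> pn; rewrite /act (big_ord_widen n (fun i => p`_i *: iter i H x)) //.
rewrite big_mkcond; apply: eq_bigr => i _; case: ltnP => // h.
by rewrite nth_default // scale0r.
Qed.

Lemma actD p q x : act (p + q) x = act p x + act q x.
Proof.
pose n := maxn (size p) (size q).
rewrite !(@act_wide n) ?leq_maxl ?leq_maxr ?size_polyD //.
by rewrite -big_split; apply: eq_bigr => i _; rewrite coefD scalerDl.
Qed.

Lemma actZ k p x : act (k *: p) x = k *: act p x.
Proof.
rewrite !(@act_wide (size p)) ?size_scale_leq // scaler_sumr.
by apply: eq_bigr => i _; rewrite coefZ scalerA.
Qed.

Lemma actN p x : act (- p) x = - act p x.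
Proof. by rewrite -scaleN1r actZ scaleN1r. Qed.

Lemma actB p q x : act (p - q) x = act p x - act q x.
Proof. by rewrite actD actN. Qed.

Lemma actC c x : act c%:P x = c *: x.
Proof. by rewrite (@act_wide 1) ?size_polyC_leq1 // big_ord1 coefC. Qed.

Lemma act0 x : act 0 x = 0.
Proof. by rewrite -polyC0 actC scale0r. Qed.

Lemma act1 x : act 1 x = x.
Proof. by rewrite -polyC1 actC scale1r. Qed.

Lemma actMX p x : act (p * 'X) x = act p (H x).
Proof.
rewrite (@act_wide (size p).+1); last first.
  have [->|p0] := eqVneq p 0; first by rewrite mul0r size_poly0.
  by rewrite size_mulX.
rewrite big_ord_recl coefMX eqxx scale0r add0r.
by apply: eq_bigr => i _; rewrite coefMX lift0 iterSr.
Qed.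

Lemma actX x : act 'X x = H x.
Proof. by rewrite -['X]mul1r actMX act1. Qed.

Lemma actDr p x y : act p (x + y) = act p x + act p y.
Proof.
elim/poly_ind: p x y => [|p c IH] x y; first by rewrite !act0 addr0.
by rewrite !actD !actMX !actC opD IH scalerDr addrACA.
Qed.

Lemma act_amul p x y : act p (x ** y) = act p x ** y.
Proof.
elim/poly_ind: p x => [|p c IH] x; first by rewrite !act0 amul0l.
by rewrite !actD !actMX !actC opM IH amulDl amulZl.
Qed.

Lemma actZr p k x : act p (k *: x) = k *: act p x.
Proof.
elim/poly_ind: p x => [|p c IH] x; first by rewrite !act0 scaler0.
by rewrite !actD !actMX !actC opZ IH scalerDr !scalerA mulrC.
Qed.

Lemma act0r p : act p 0 = 0.
Proof. by rewrite -(scale0r (0 : A)) actZr !scale0r. Qed.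

Lemma actBr p x y : act p (x - y) = act p x - act p y.
Proof. by rewrite -scaleN1r actDr actZr scaleN1r. Qed.

Lemma actM p q x : act (p * q) x = act p (act q x).
Proof.
have actH r y : act r (H y) = H (act r y).
  elim/poly_ind: r y => [|r c IH] y; first by rewrite !act0 -(scale0r (0 : A)) opZ !scale0r.
  by rewrite !actD !actMX !actC opD opZ IH.
elim/poly_ind: p x => [|p c IH] x; first by rewrite mul0r !act0.
rewrite mulrDl !actD -mulrA ['X * q]mulrC mulrA !actMX IH mul_polyC actZ actC.
by rewrite actH.
Qed.

Definition bnd p (M : R) := forall x, rn (act p x) <= M * rn x.

Lemma bndD p q M N : bnd p M -> bnd q N -> bnd (p + q) (M + N).
Proof.
by move=> hp hq x; rewrite actD mulrDl (le_trans (rnD _ _))// lerD.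
Qed.

Lemma bndM p q M N : 0 <= M -> bnd p M -> bnd q N -> bnd (p * q) (M * N).
Proof.
move=> M0 hp hq x; rewrite actM (le_trans (hp _))// -mulrA.
exact: ler_wpM2l.
Qed.

Lemma bnd1 : bnd 1 1.
Proof. by move=> x; rewrite act1 mul1r. Qed.

Lemma bndX p M n : 0 <= M -> bnd p M -> bnd (p ^+ n) (M ^+ n).
Proof.
move=> M0 hp; elim: n => [|n IH]; first exact: bnd1.
by rewrite !exprS; apply: bndM.
Qed.

Lemma bndW p M N : M <= N -> bnd p M -> bnd p N.
Proof. by move=> MN hp x; rewrite (le_trans (hp x))// ler_wpM2r// rn_ge0. Qed.

Lemma bndZ k p M : bnd p M -> bnd (k *: p) (complex.Re `|k| * M).
Proof.
move=> hp x; rewrite actZ rnZ -mulrA ler_wpM2l //.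
by rewrite -ler0c RRe_real // ger0_real.
Qed.

Lemma bnd_sum (I : Type) (r : seq I) (P : pred I)
    (F : I -> {poly R[i]}) (M : I -> R) :
  (forall i, P i -> bnd (F i) (M i)) ->
  bnd (\sum_(i <- r | P i) F i) (\sum_(i <- r | P i) M i).
Proof.
move=> h; elim/big_ind2: _ => [x|p N q L|//]; last exact: bndD.
by rewrite act0 rn0 mul0r.
Qed.

Lemma cstar_act p x y :
  cstar (act p x) ** y = cstar x ** act (map_poly Num.conj p) y.
Proof.
elim/poly_ind: p x y => [|p c IH] x y.
  by rewrite rmorph0 !act0 cstar0 amul0l amul0r.
rewrite rmorphD rmorphM /= map_polyX map_polyC /= !actD !actMX !actC.
by rewrite cstarD cstarZ amulDl amulDr amulZl amulZr IH op_sa -!actMX mulrC actM actX.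
Qed.

(** The C*-identity turns the squared norm of [act p x] into the norm of [cstar x] times the action
    of [conj p * p] on [x]. *)
Lemma bnd_conjM p M : 0 <= M ->
  bnd (map_poly Num.conj p * p) (M ^+ 2) -> bnd p M.
Proof.
move=> M0 h x; rewrite -(@ler_pXn2r _ 2) ?nnegrE ?mulr_ge0 ?rn_ge0 //.
rewrite -rn_cstarM cstar_act -actM (le_trans (rnM _ _))// rn_cstar.
by rewrite exprMn mulrC [rn x ^+ 2]expr2 mulrA ler_wpM2r ?rn_ge0.
Qed.

End Act.

(** If [t = 1 + u] with [u > 0], Bernoulli's inequality bounds [t^n] below by [1 + n u]; its square
    grows quadratically along the exponents [2 n] and outruns the linear bound. *)
Lemma pow2_growth (R : realType) (t a b : R) : 0 <= t ->
  (forall r, t ^+ (2 ^ r) <= a * (2 ^ r)%:R + b) -> t <= 1.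
Proof.
move=> t0 h; rewrite leNgt; apply/negP => t1.
pose u := t - 1; have u0 : 0 < u by rewrite subr_gt0.
have bern n : 1 + n%:R * u <= t ^+ n.
  elim: n => [|n IH]; first by rewrite mul0r addr0.
  rewrite exprS -natr1; have : t * (1 + n%:R * u) <= t * t ^+ n by rewrite ler_wpM2l.
  apply: le_trans; have -> : t = 1 + u by rewrite /u addrC subrK.
  have n0 : 0 <= n%:R :> R by [].
  nra.
pose C := 2 * `|a| + `|b|.
have [N HN] : exists N : nat, C < N%:R * u ^+ 2.
  exists (Num.bound (C / u ^+ 2)); rewrite -ltr_pdivrMr ?exprn_gt0 //.
  rewrite archi_boundP // divr_ge0 //; last by rewrite exprn_ge0 // ltW.
  by rewrite addr_ge0 // mulr_ge0.
have := h N.+1; apply/negP; rewrite -ltNge expnS mulnC exprM.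
pose n := (2 ^ N)%N; rewrite -/n.
have nN : N%:R <= n%:R :> R by rewrite ler_nat ltnW // ltn_expl.
have n1 : 1 <= n%:R :> R by rewrite ler1n expn_gt0.
have /lt_le_trans -> // : a * (n * 2)%:R + b < (1 + n%:R * u) ^+ 2; last first.
  by rewrite lerXn2r ?nnegrE ?exprn_ge0 ?addr_ge0 ?mulr_ge0 ?(ltW u0).
rewrite natrM; have ha := ler_norm a; have hb := ler_norm b.
have a0 := normr_ge0 a; have b0 := normr_ge0 b.
have h1 : n%:R * C <= n%:R * (n%:R * u ^+ 2).
  apply: ler_wpM2l => //; apply: le_trans (ltW HN) _.
  by rewrite ler_wpM2r ?exprn_ge0 // ltW.
have h2 : b <= n%:R * `|b| by nra.
have h3 : a * (n%:R * 2) <= n%:R * (2 * `|a|) by nra.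
have -> : (1 + n%:R * u) ^+ 2 = 1 + 2 * (n%:R * u) + n%:R * (n%:R * u ^+ 2) by ring.
have h4 : 0 <= n%:R * u by rewrite mulr_ge0 // ltW.
rewrite /C in h1; nra.
Qed.

Lemma pow2_growth_le (R : realType) (t d a b : R) : 0 <= t -> 0 <= d ->
  (forall r, t ^+ (2 ^ r) <= (a * (2 ^ r)%:R + b) * d ^+ (2 ^ r)) -> t <= d.
Proof.
move=> t0 d0 h; have [d1|d1] := eqVneq d 0.
  by move: (h 0%N); rewrite d1 expn0 !expr1 mulr0.
have dp : 0 < d by rewrite lt_neqAle eq_sym d1 d0.
rewrite -[leRHS]mul1r -ler_pdivrMr //.
apply: (@pow2_growth _ _ a b) => [|r]; first by rewrite divr_ge0.
by rewrite expr_div_n ler_pdivrMr ?exprn_gt0.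
Qed.

Lemma complex_prim_root (R : rcfType) n : (0 < n)%N ->
  exists w : R[i], n.-primitive_root w /\ `|w| = 1.
Proof.
move=> n0; pose p : {poly R[i]} := 'X^n - 1.
have [rs def_p] := closed_field_poly_normal p.
have p_monic : p \is monic by exact: monic_Xn_sub_1.
have {}def_p : p = \prod_(z <- rs) ('X - z%:P).
  by rewrite def_p (monicP p_monic) scale1r.
have rsn1 : all n.-unity_root rs.
  by apply/allP=> z; rewrite -root_prod_XsubC -def_p.
have sz : (n <= size rs)%N.
  have := size_prod_XsubC rs id; rewrite -def_p size_Xn_sub_1 // => -[->]; exact: leqnn.
have urs : uniq rs.
  rewrite -separable_prod_XsubC -def_p; apply: separable_Xn_sub_1.
  by rewrite pnatr_eq0 -lt0n.
have /hasP[w _ wp] := has_prim_root n0 rsn1 urs sz.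
exists w; split=> //; have /(congr1 Num.norm) := prim_expr_order wp.
rewrite normrX normr1 => /eqP; by rewrite pexpr_eq1 // => /eqP.
Qed.

Lemma prim_root_sum (F : fieldType) n (w : F) (k : nat) : n.-primitive_root w ->
  \sum_(j < n) (w ^+ k) ^+ j = if (n %| k)%N then n%:R else 0.
Proof.
move=> wp; rewrite (prim_order_dvd wp k); case: eqP => [->|/eqP h].
  by under eq_bigr do rewrite expr1n; rewrite sumr_const card_ord.
have h' : w ^+ k - 1 != 0 by rewrite subr_eq0.
apply: (mulfI h'); rewrite -subrX1 -exprM mulnC exprM (prim_expr_order wp).
by rewrite expr1n subrr mulr0.
Qed.

(** * Bernstein polynomials *)

Section PolyUnitInterval.
Variable R : realType.
Implicit Types p P Q : {poly R}.

Definition bern (m k : nat) : {poly R} := ((1 - 'X) ^+ (m - k) * 'X ^+ k) *+ 'C(m, k).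

Lemma bern_sum m : \sum_(k < m.+1) bern m k = 1.
Proof. by rewrite -exprDn subrK expr1n. Qed.

Lemma bernS0 m : bern m.+1 0 = (1 - 'X) * bern m 0.
Proof. by rewrite /bern !bin0 !subn0 exprS !expr0 !mulr1 !mulr1n. Qed.

Lemma bernSS m k : bern m.+1 k.+1 = 'X * bern m k + (1 - 'X) * bern m k.+1.
Proof.
rewrite /bern binS subSS mulrnDr addrC -!mulrnAr; congr (_ + _).
  by rewrite !mulrnAr [in LHS]exprS; congr (_ *+ _); ring.
have [km|mk] := ltnP k m; last by rewrite bin_small ?ltnS // !mulr0n !mulr0.
by rewrite -(subnSK km) exprS mulrA.
Qed.

Lemma bern_over m : bern m m.+1 = 0.
Proof. by rewrite /bern bin_small. Qed.

Lemma bern_mulX m k :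
  (k.+1%:R / m.+1%:R) *: bern m.+1 k.+1 = 'X * bern m k.
Proof.
have bE n l : bern n l = 'C(n, l)%:R *: ((1 - 'X) ^+ (n - l) * 'X ^+ l).
  by rewrite scaler_nat.
have E : (k.+1%:R / m.+1%:R) * ('C(m.+1, k.+1))%:R = ('C(m, k))%:R :> R.
  apply: (mulfI (_ : m.+1%:R != 0)); first by rewrite pnatr_eq0.
  rewrite mulrA mulrCA divff ?pnatr_eq0 // mulr1 -!natrM; congr (_%:R).
  by rewrite -mul_bin_diag.
rewrite !bE scalerA E subSS -scalerAr; congr (_ *: _).
by rewrite exprS mulrCA.
Qed.

Lemma bern_mul1X m k :
  (1 - k%:R / m.+1%:R) *: bern m.+1 k = (1 - 'X) * bern m k.
Proof.
case: k => [|k]; first by rewrite mul0r subr0 scale1r bernS0.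
by rewrite scalerBl scale1r bern_mulX bernSS addrC addKr.
Qed.

(* The de Casteljau recursion, which reduces bounds on Bernstein forms to
   bounds on convex combinations. *)
Lemma casteljau m (a : nat -> R) :
  \sum_(k < m.+2) a k *: bern m.+1 k =
  'X * (\sum_(k < m.+1) a k.+1 *: bern m k) +
  (1 - 'X) * (\sum_(k < m.+1) a k *: bern m k).
Proof.
rewrite big_ord_recl bernS0.
under eq_bigr do rewrite lift0 bernSS scalerDr.
rewrite big_split /= addrCA; congr (_ + _).
  by rewrite mulr_sumr; apply: eq_bigr => i _; rewrite scalerAr.
rewrite big_ord_recr /= bern_over mulr0 scaler0 addr0.
rewrite big_ord_recl mulrDr scalerAr; congr (_ + _).
by rewrite mulr_sumr; apply: eq_bigr => i _; rewrite lift0 scalerAr.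
Qed.

Lemma poly_lipschitz01 p : exists2 L : R, 0 <= L &
  forall s t, 0 <= s <= 1 -> 0 <= t <= 1 -> `|p.[s] - p.[t]| <= L * `|s - t|.
Proof.
elim/poly_ind: p => [|p c [L L0 hL]].
  by exists 0 => // s t _ _; rewrite !horner0 subr0 normr0 mul0r.
exists (L + (`|p.[0]| + L)) => [|s t hs ht].
  by rewrite !addr_ge0.
rewrite !hornerMXaddC.
have -> : p.[s] * s + c - (p.[t] * t + c) = (p.[s] - p.[t]) * s + p.[t] * (s - t) by ring.
have bt : `|p.[t]| <= `|p.[0]| + L.
  have h0 : 0 <= (0 : R) <= 1 by rewrite lexx ler01.
  have -> : p.[t] = p.[0] + (p.[t] - p.[0]) by rewrite addrC subrK.
  apply: le_trans (ler_normD _ _) _; apply: lerD => //.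
  apply: le_trans (hL _ _ ht h0) _; rewrite subr0 ger0_norm; last by case/andP: ht.
  by rewrite ler_piMr //; case/andP: ht.
apply: le_trans (ler_normD _ _) _; rewrite !normrM [leRHS]mulrDl; apply: lerD.
  case/andP: (hs) => s0 s1; rewrite (ger0_norm s0).
  apply: le_trans (hL _ _ hs ht); exact: ler_piMr.
by rewrite ler_wpM2r.
Qed.

(** Horner induction: if [p] has coefficients [a k] in degree [M], then [p * 'X + c] has
    coefficients [c + k / (M + 1) * a (k - 1)] in degree [M + 1]. The nodes move by at most [1 / M],
    which the Lipschitz constant of [p] absorbs. *)
Lemma bern_elevation p (e : R) : 0 < e -> exists M0 : nat, forall M, (M0 <= M)%N ->
  exists2 a : nat -> R, p = \sum_(k < M.+1) a k *: bern M k &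
    forall k, (k <= M)%N -> `|a k - p.[k%:R / M%:R]| <= e.
Proof.
elim/poly_ind: p e => [|p c IH] e e0.
  exists 0%N => M _; exists (fun=> 0) => [|k _]; last by rewrite horner0 subr0 normr0 ltW.
  by rewrite big1 // => i _; rewrite scale0r.
have e2 : 0 < e / 2 by rewrite divr_gt0.
have [M0 HM0] := IH _ e2; have [L L0 hL] := poly_lipschitz01 p.
pose M1 := Num.bound (L / (e / 2)).
have hM1 : L / (e / 2) < M1%:R by rewrite archi_boundP // divr_ge0 // ltW.
exists (maxn M0 M1).+1 => -[//|M]; rewrite ltnS geq_max => /andP[M0M M1M].
have [a pE ha] := HM0 _ M0M.
(* At [k = 0] the factor [k / M.+1] vanishes, so the truncated predecessor does no harm. *)
exists (fun k => c + (k%:R / M.+1%:R) * a k.-1) => [|[|k] kM].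
- under eq_bigr do rewrite scalerDl.
  rewrite big_split -scaler_sumr bern_sum alg_polyC addrC; congr (_ + _).
  rewrite big_ord_recl [X in _ = X + _](_ : _ = 0) ?add0r; last first.
    by rewrite /= !mul0r scale0r.
  rewrite [in LHS]pE mulr_suml; apply: eq_bigr => i _.
  by rewrite lift0 /= [_ * a i]mulrC -scalerA bern_mulX -scalerAl [_ * 'X]mulrC.
- by rewrite !mul0r hornerMXaddC mulr0 add0r addr0 subrr normr0 ltW.
rewrite ltnS in kM; rewrite hornerMXaddC /=.
set v : R := k.+1%:R / M.+1%:R; set u : R := k%:R / M%:R.
have v01 : 0 <= v <= 1.
  by rewrite divr_ge0 //= ler_pdivrMr ?ltr0n // mul1r ler_nat.
have -> : c + v * a k - (p.[v] * v + c) = v * ((a k - p.[u]) + (p.[u] - p.[v])) by ring.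
rewrite normrM (ger0_norm (_ : 0 <= v)); last by case/andP: v01.
apply: (@le_trans _ _ `|a k - p.[u] + (p.[u] - p.[v])|).
  by rewrite ler_piMl //; case/andP: v01.
apply: le_trans (ler_normD _ _) _; rewrite [leRHS]splitr; apply: lerD; first exact: ha.
(* [M = 0] is impossible, as [M] is at least [M1], which exceeds a nonnegative real. *)
have [M00|Mp] := posnP M.
  have k0 : k = 0%N by move: kM; rewrite M00 leqn0 => /eqP.
  have L1 : L / (e / 2) < 0%:R by apply: lt_le_trans hM1 _; rewrite ler_nat -M00.
  by move: L1; rewrite ltNge divr_ge0 // ltW.
have Mr : 0 < M%:R :> R by rewrite ltr0n.
have u01 : 0 <= u <= 1.
  by rewrite divr_ge0 //= ler_pdivrMr // mul1r ler_nat.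
apply: le_trans (hL _ _ u01 v01) _.
have uv : `|u - v| <= M%:R^-1.
  have -> : u - v = - ((M - k)%:R / M.+1%:R) / M%:R.
    rewrite /u /v natrB // -!natr1; field.
    by rewrite natr1 !pnatr_eq0 andbT -lt0n.
  rewrite normrM normrN !ger0_norm ?invr_ge0 // ?divr_ge0 //.
  rewrite ler_piMl ?invr_ge0 // ler_pdivrMr ?ltr0n // mul1r ler_nat.
  by rewrite (leq_trans (leq_subr _ _)).
apply: le_trans (ler_wpM2l L0 uv) _; rewrite ler_pdivrMr //.
rewrite mulrC -ler_pdivrMr //; apply: ltW; apply: lt_le_trans hM1 _.
by rewrite ler_nat.
Qed.

End PolyUnitInterval.

(** * The supremum bound for polynomials *)

Section RealCalculus.
Variables (R : realType) (A : cstarAlgType R) (H : posop A).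
Implicit Types (x y : A) (p q : {poly R}).

Definition ract p := act H (map_poly (real_complex R) p).

Definition rbnd p (M : R) := bnd H (map_poly (real_complex R) p) M.

Lemma ractD p q x : ract (p + q) x = ract p x + ract q x.
Proof. by rewrite /ract rmorphD actD. Qed.

Lemma ractB p q x : ract (p - q) x = ract p x - ract q x.
Proof. by rewrite /ract rmorphB actB. Qed.

Lemma ractM p q x : ract (p * q) x = ract p (ract q x).
Proof. by rewrite /ract rmorphM actM. Qed.

Lemma ract1 x : ract 1 x = x.
Proof. by rewrite /ract rmorph1 act1. Qed.

Lemma ractX x : ract 'X x = H x.
Proof. by rewrite /ract map_polyX actX. Qed.

Lemma ractC (c : R) x : ract c%:P x = c%:C%C *: x.
Proof. by rewrite /ract map_polyC actC. Qed.

Lemma ractZ (c : R) p x : ract (c *: p) x = c%:C%C *: ract p x.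
Proof. by rewrite /ract map_polyZ actZ. Qed.

Lemma ractDr p x y : ract p (x + y) = ract p x + ract p y.
Proof. exact: actDr. Qed.

Lemma ractBr p x y : ract p (x - y) = ract p x - ract p y.
Proof. exact: actBr. Qed.

Lemma ractZr p k x : ract p (k *: x) = k *: ract p x.
Proof. exact: actZr. Qed.

Lemma ract_amul p x y : ract p (x ** y) = ract p x ** y.
Proof. exact: act_amul. Qed.

Lemma ract0r p : ract p 0 = 0.
Proof. exact: act0r. Qed.

Lemma ract_ind (S : A -> Prop) p x :
  (forall u v, S u -> S v -> S (u + v)) -> (forall k u, S u -> S (k *: u)) ->
  (forall u, S u -> S (H u)) -> S x -> S (ract p x).
Proof.
move=> SD SZ SH Sx; have S0 : S 0 by rewrite -(scale0r x); exact: SZ.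
rewrite /ract /act; elim/big_ind: _ => // i _; apply: SZ.
by elim: (i : nat) => //= n; exact: SH.
Qed.

Lemma conj_map_real p :
  map_poly Num.conj (map_poly (real_complex R) p) = map_poly (real_complex R) p.
Proof.
rewrite -map_poly_comp; apply: eq_map_poly => r.
exact: conjc_real.
Qed.

Lemma cstar_ract p x y : cstar (ract p x) ** y = cstar x ** ract p y.
Proof. by rewrite cstar_act conj_map_real. Qed.

Lemma ract_logconvex p x : rn (ract p x) ^+ 2 <= rn x * rn (ract (p ^+ 2) x).
Proof.
rewrite -rn_cstarM cstar_ract -ractM -expr2 (le_trans (rnM _ _))//.
by rewrite rn_cstar.
Qed.

(** As in the spectral radius formula: by log-convexity the ratios [f r] satisfy
    [f r ^+ 2 <= f r.+1], so [f 0 ^+ (2 ^ r)] is below the assumed bound and the linear factor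
    disappears. *)
Lemma rbnd_pow2 p (a b d : R) : 0 <= d ->
  (forall r, rbnd (p ^+ (2 ^ r)) ((a * (2 ^ r)%:R + b) * d ^+ (2 ^ r))) ->
  rbnd p d.
Proof.
move=> d0 h x.
have [x0|x0] := eqVneq (rn x) 0.
  by rewrite (rn_eq0 x0) act0r rn0 mulr0.
have xp : 0 < rn x by rewrite lt_neqAle eq_sym x0 rn_ge0.
pose f r := rn (ract (p ^+ (2 ^ r)) x) / rn x.
have f_ge0 r : 0 <= f r by rewrite divr_ge0 // rn_ge0.
have fS r : f r ^+ 2 <= f r.+1.
  rewrite /f expr_div_n ler_pdivrMr ?exprn_gt0 // expnS mulnC exprM.
  apply: le_trans (ract_logconvex _ _) _.
  by rewrite mulrC -[leRHS]mulrA [_^-1 * _]mulrC expr2 mulfK.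
have fpow r : f 0%N ^+ (2 ^ r) <= f r.
  elim: r => [|r IH]; first by rewrite expn0 expr1.
  by rewrite expnS mulnC exprM (le_trans _ (fS r)) // lerXn2r ?nnegrE ?exprn_ge0.
have fh r : f r <= (a * (2 ^ r)%:R + b) * d ^+ (2 ^ r).
  by rewrite /f ler_pdivrMr //; exact: h.
suff : f 0%N <= d by rewrite /f expn0 expr1 ler_pdivrMr.
apply: (@pow2_growth_le _ _ _ a b) => // r.
exact: le_trans (fpow r) (fh r).
Qed.

Lemma ReZ_norm_sum (z t : R[i]) : 0 <= z -> 0 <= t ->
  complex.Re `|z| + complex.Re `|t| = complex.Re (z + t).
Proof. by move=> z0 t0; rewrite !ger0_norm // raddfD. Qed.

(** With [S = 2 X - 1] the operator is half of [(1 + w) + (w - 1) S]. In its product with its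
    adjoint the cross terms cancel because [|w| = 1], and the parallelogram identity
    [|1 + w|^2 + |w - 1|^2 = 4] gives norm at most 1. *)
Lemma bnd_rotation (w : R[i]) : `|w| = 1 -> bnd H (1 - 'X + w *: 'X) 1.
Proof.
move=> w1; apply: bnd_conjM => //; rewrite expr1n.
have wJ : w * Num.conj w = 1 by rewrite -normCK w1 expr1n.
set v := Num.conj w in wJ *.
have -> : map_poly Num.conj (1 - 'X + w *: 'X) = 1 - 'X + v *: 'X.
  by rewrite rmorphD rmorphB rmorph1 /= map_polyZ /= map_polyX.
pose S : {poly R[i]} := 2%:R *: 'X - 1.
have bS : bnd H (S ^+ 2) (1 ^+ 2).
  by apply: bndX => // x; rewrite actB actZ actX act1 mul1r op_contr.
have E : (1 - 'X + v *: 'X) * (1 - 'X + w *: 'X) =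
    4%:R^-1 *: (((1 + w) * (1 + v))%:P + ((w - 1) * (v - 1)) *: S ^+ 2).
  apply: (@scalerI _ _ 4%:R); first by rewrite pnatr_eq0.
  rewrite scalerA divff ?pnatr_eq0 // scale1r.
  have wP : w%:P * v%:P = 1 by rewrite -polyCM wJ.
  rewrite /S -!mul_polyC !(polyCM, polyCD, polyCB, polyCN) !polyC1.
  apply/eqP; rewrite -subr_eq0; apply/eqP.
  transitivity ((w%:P * v%:P - 1) * (4%:R * 'X - 2%:R) : {poly R[i]}); first by ring.
  by rewrite wP subrr mul0r.
have Jge0 (u : R[i]) : 0 <= u * Num.conj u by rewrite -normCK exprn_ge0.
rewrite E; apply: (@bndW _ _ _ _
  (complex.Re `|4%:R^-1 : R[i]| * (complex.Re `|(1 + w) * (1 + v)| * 1 +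
    complex.Re `|(w - 1) * (v - 1)| * 1 ^+ 2))); last first.
  apply: bndZ; apply: bndD; last exact: bndZ.
  by rewrite -alg_polyC; apply: bndZ; exact: bnd1.
rewrite expr1n !mulr1 ReZ_norm_sum; last 2 first.
- by have := Jge0 (1 + w); rewrite rmorphD rmorph1.
- by have := Jge0 (w - 1); rewrite rmorphB rmorph1.
have -> : (1 + w) * (1 + v) + (w - 1) * (v - 1) = 4%:R.
  by transitivity (2%:R + 2%:R * (w * v)); [ring|rewrite wJ; ring].
rewrite ger0_norm ?invr_ge0 // -[4%:R : R[i]](rmorph_nat (real_complex R)).
by rewrite -fmorphV /= mulVf // pnatr_eq0.
Qed.

(* [bern m k] is the coefficient of [w^k] in [(1 - X + w X)^m], extracted by
   averaging over the roots of unity; the rotations have norm at most 1. *)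
Lemma rbnd_bern m k : rbnd (bern R m k) 1.
Proof.
have [km|mk] := leqP k m; last first.
  by move=> x; rewrite /bern bin_small // mulr0n rmorph0 act0 rn0 mul1r rn_ge0.
have [w [wp w1]] := @complex_prim_root R m.+1 (ltn0Sn m).
set T := fun v : R[i] => 1 - 'X + v *: 'X.
(* [w ^+ (m.+1 - k)] stands for the inverse of [w ^+ k]. The average keeps the indices [i] with
   [m.+1] dividing [m.+1 - k + i], that is, only [i = k]. *)
have E : map_poly (real_complex R) (bern R m k) =
    m.+1%:R^-1 *: \sum_(j < m.+1) (w ^+ (m.+1 - k)) ^+ j *: T (w ^+ j) ^+ m.
  apply: (@scalerI _ _ m.+1%:R); first by rewrite pnatr_eq0.
  rewrite scalerA divff ?pnatr_eq0 // scale1r.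
  pose B (i : nat) : {poly R[i]} := ((1 - 'X) ^+ (m - i) * 'X ^+ i) *+ 'C(m, i).
  have TE v : T v ^+ m = \sum_(i < m.+1) v ^+ i *: B i.
    rewrite exprDn; apply: eq_bigr => i _.
    by rewrite exprZn -scalerAr scalerMnr.
  under eq_bigr do rewrite TE scaler_sumr.
  have sumE (i : 'I_m.+1) :
      \sum_(j < m.+1) (w ^+ (m.+1 - k)) ^+ j *: ((w ^+ j) ^+ i *: B i) =
      (if i == k :> nat then m.+1%:R else 0) *: B i.
    have -> : (i == k :> nat) = (m.+1 %| m.+1 - k + i)%N.
      apply/eqP/idP => [->|]; first by rewrite subnK // ltnW.
      have [ik|ki] := ltnP i k.
        rewrite gtnNdvd //; first by rewrite addn_gt0 subn_gt0 ltnS km.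
        by have := ltn_ord i; lia.
      have -> : (m.+1 - k + i = m.+1 + (i - k))%N by lia.
      rewrite dvdn_addr // => /dvdn_leq; have := ltn_ord i.
      by case: (posnP (i - k)) => [|/[swap] i_lt /[swap] /(_ isT)]; lia.
    rewrite -(prim_root_sum _ wp) scaler_suml; apply: eq_bigr => j _.
    by rewrite scalerA -!exprM -exprD; congr (w ^+ _ *: _); lia.
  rewrite exchange_big /= (eq_bigr _ (fun i _ => sumE i)).
  have kS : (k < m.+1)%N by [].
  rewrite (bigD1 (Ordinal kS)) //= eqxx big1 ?addr0 => [|i]; last first.
    by rewrite -val_eqE /= => /negPf ->; rewrite scale0r.
  rewrite /B /bern rmorphMn /= rmorphM rmorphXn rmorphXn rmorphB rmorph1 /= map_polyX.
  by rewrite scaler_nat.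
rewrite /rbnd E; apply: (@bndW _ _ _ _ (complex.Re `|m.+1%:R^-1 : R[i]| *
  \sum_(j < m.+1) 1)); last first.
  apply: bndZ; apply: bnd_sum => j _.
  have wj l : `|(w ^+ j) ^+ l| = 1 by rewrite !normrX w1 !expr1n.
  rewrite -[1]mulr1 -{2}(expr1n _ m) -{1}(Re_norm1 (_ : `|(w ^+ (m.+1 - k)) ^+ j| = 1)).
    apply: bndZ; apply: bndX => //; apply: bnd_rotation; by have := wj 1%N; rewrite expr1.
  by rewrite !normrX w1 !expr1n.
rewrite sumr_const card_ord normfV normr_nat -(rmorph_nat (real_complex R)).
by rewrite -fmorphV /= mulVf // pnatr_eq0.
Qed.

(* The binomial theorem bounds the [n]-th power by [(n + 1) d^n]. *)
Lemma rbnd_convex p q d : 0 <= d -> rbnd p d -> rbnd q d ->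
  rbnd ('X * p + (1 - 'X) * q) d.
Proof.
move=> d0 hp hq; apply: (@rbnd_pow2 _ 1 1) => // r.
set n := (2 ^ r)%N.
have -> : ('X * p + (1 - 'X) * q) ^+ n =
    \sum_(i < n.+1) bern R n i * (p ^+ i * q ^+ (n - i)).
  rewrite addrC exprDn; apply: eq_bigr => i _.
  by rewrite /bern !exprMn mulrnAl; congr (_ *+ _); ring.
have -> : (1 * n%:R + 1) * d ^+ n = \sum_(i < n.+1) 1 * (d ^+ i * d ^+ (n - i)).
  under eq_bigr => i _ do rewrite mul1r -exprD subnKC ?leq_ord //.
  by rewrite sumr_const card_ord mul1r natr1 mulr_natl.
rewrite /rbnd rmorph_sum; apply: bnd_sum => i _; rewrite !rmorphM !rmorphXn.
apply: bndM => //; first exact: rbnd_bern.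
by apply: bndM; [exact: exprn_ge0|exact: bndX|exact: bndX].
Qed.

Lemma rbnd_bern_form m (a : nat -> R) d : 0 <= d ->
  (forall k, (k <= m)%N -> `|a k| <= d) ->
  rbnd (\sum_(k < m.+1) a k *: bern R m k) d.
Proof.
move=> d0; elim: m a => [|m IH] a ha.
  rewrite big_ord1 /bern bin0 subn0 !expr0 mulr1 mulr1n => x.
  by rewrite -/(ract _) ractZ ract1 rnZr ler_wpM2r ?rn_ge0 ?ha.
rewrite casteljau; apply: rbnd_convex => //.
  by apply: (IH (fun k => a k.+1)) => k km; apply: ha.
by apply: IH => k km; apply: ha; exact: leqW.
Qed.

(** In high degree the Bernstein coefficients of [p] lie within [e] of values of [p], hence are
    bounded by [M + e]. *)
Theorem rbnd_sup p M : (forall t, 0 <= t <= 1 -> `|p.[t]| <= M) -> rbnd p M.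
Proof.
move=> hp x.
have M0 : 0 <= M by apply: le_trans (hp 0 _) => //; rewrite lexx ler01.
suff h e : 0 < e -> rn (ract p x) <= (M + e) * rn x.
  apply/ler_addgt0Pr => e e0; have x1 : 0 < rn x + 1 by rewrite ltr_pwDr ?rn_ge0.
  apply: le_trans (h _ (divr_gt0 e0 x1)) _; rewrite mulrDl lerD2l.
  rewrite mulrAC ler_pdivrMr // ler_wpM2l ?(ltW e0) //.
  by rewrite lerDl.
move=> e0; have [N hN] := bern_elevation p e0.
have [a pE ha] := hN _ (leqnSn N); rewrite [in ract p]pE.
apply: rbnd_bern_form => [|k kN]; first by rewrite addr_ge0 // ltW.
have := hp (k%:R / N.+1%:R) _; rewrite divr_ge0 //= ler_pdivrMr ?ltr0n // mul1r ler_nat.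
move=> /(_ kN) h; have -> : a k = p.[k%:R / N.+1%:R] + (a k - p.[k%:R / N.+1%:R]).
  by rewrite addrC subrK.
by apply: le_trans (ler_normD _ _) _; apply: lerD => //; exact: ha.
Qed.

End RealCalculus.

(** * Approximate units *)

Section Damping.
Variable R : realType.

(* With ['X] read as [(1 + s) / 2], [polyY] stands for [s] itself, and
   [damp n] for [(1 - s^2)^n]. *)
Definition polyY : {poly R} := 2%:R *: 'X - 1.

Definition damp n : {poly R} := (1 - polyY ^+ 2) ^+ n.

Lemma polyY_horner t : polyY.[t] = 2 * t - 1.
Proof. by rewrite /polyY !hornerE. Qed.

Lemma polyY_norm (t : R) : 0 <= t <= 1 -> `|2 * t - 1| <= 1.
Proof. by move=> /andP[t0 t1]; rewrite ler_norml; lra. Qed.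

Lemma damp_horner n t : (damp n).[t] = (1 - (2 * t - 1) ^+ 2) ^+ n.
Proof. by rewrite /damp horner_exp hornerD hornerN horner_exp polyY_horner hornerC. Qed.

Lemma damp01 n (t : R) : 0 <= t <= 1 -> 0 <= (damp n).[t] <= 1.
Proof.
move=> /polyY_norm h; rewrite damp_horner.
have : 0 <= 1 - (2 * t - 1) ^+ 2 <= 1.
  by rewrite subr_ge0 gerBl sqr_ge0 andbT -real_normK ?num_real // expr_le1.
by case/andP=> h0 h1; rewrite exprn_ge0 // exprn_ile1.
Qed.

Lemma one_sub_damp n : exists g, 1 - damp n = polyY * (polyY * g).
Proof.
exists (\sum_(i < n) (1 - polyY ^+ 2) ^+ i).
by rewrite mulrA -expr2 /damp -opprB subrX1 -mulNr; congr (_ * _); ring.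
Qed.

End Damping.

(** * Multiplication by a selfadjoint contraction *)

Section ElementOperator.
Variables (R : realType) (A : cstarAlgType R) (s : A).
Hypotheses (s_sa : cstar s = s) (s_le1 : rn s <= 1).

Let H (x : A) := 2%:R^-1 *: (x + s ** x).

Lemma element_opD x y : H (x + y) = H x + H y.
Proof. by rewrite /H amulDr addrACA scalerDr. Qed.

Lemma element_opZ k x : H (k *: x) = k *: H x.
Proof. by rewrite /H amulZr -scalerDr !scalerA mulrC. Qed.

Lemma element_opM x y : H (x ** y) = H x ** y.
Proof. by rewrite /H amulA -amulDl amulZl. Qed.

Lemma element_op_sa x y : cstar (H x) ** y = cstar x ** H y.
Proof.
rewrite /H cstarZ fmorphV rmorph_nat cstarD cstarM s_sa.
by rewrite amulZl amulZr amulDl amulDr amulA.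
Qed.

Lemma element_op_contr x : rn (2%:R *: H x - x) <= rn x.
Proof.
rewrite /H scalerA divff ?pnatr_eq0 // scale1r addrC addKr.
by rewrite (le_trans (rnM _ _))// ler_piMl ?rn_ge0.
Qed.

Definition element_op : posop A := Posop element_opD element_opZ
  element_opM element_op_sa element_op_contr.

Lemma ract_polyY x : ract element_op (polyY R) x = s ** x.
Proof.
rewrite ractB ractZ ractX ract1 /= /H (rmorph_nat (real_complex R)) scalerA.
by rewrite divff ?pnatr_eq0 // scale1r addrC addKr.
Qed.

Section Ideal.
Variable J : ideal A.

Lemma idealN x : ideal_set J x -> ideal_set J (- x).
Proof. by move=> Jx; rewrite -scaleN1r; exact: idealZ. Qed.

Lemma idealB x y : ideal_set J x -> ideal_set J y -> ideal_set J (x - y).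
Proof. by move=> Jx Jy; apply: idealD => //; exact: idealN. Qed.

Lemma ideal_element_op x : ideal_set J x -> ideal_set J (element_op x).
Proof. by move=> Jx; apply: idealZ; apply: idealD => //; exact: idealMl. Qed.

Lemma ideal_ract p x : ideal_set J x -> ideal_set J (ract element_op p x).
Proof.
move=> Jx; apply: (@ract_ind _ _ _ (ideal_set J)) => //.
- exact: idealD.
- exact: idealZ.
- exact: ideal_element_op.
Qed.

Hypothesis s_centr : forall x, ideal_set J (s ** x - x ** s).

Lemma ract_centr p x y :
  ideal_set J (y ** ract element_op p x - ract element_op p (y ** x)).
Proof.
elim/poly_ind: p x => [|p c IH] x.
  by rewrite /ract rmorph0 !act0 amul0r subr0; exact: ideal0.
rewrite !ractD !ractM !ractX !ractC amulDr amulZr opprD addrACA subrr addr0.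
rewrite -[X in ideal_set J X](subrKA (ract element_op p (y ** element_op x))).
apply: idealD; first exact: IH.
rewrite -ractBr; apply: ideal_ract => /=.
rewrite /H amulZr -scalerBr amulDr opprD addrACA subrr add0r !amulA -amulBl.
by apply: idealZ; apply: idealMr; rewrite -opprB; exact: idealN.
Qed.

End Ideal.
End ElementOperator.

Lemma bern_le1 (R : realType) m k (t : R) : 0 <= t <= 1 -> 0 <= (bern R m k).[t] <= 1.
Proof.
move=> /andP[t0 t1].
have ge0 i : 0 <= (bern R m i).[t].
  by rewrite /bern hornerMn hornerM !horner_exp !hornerE mulrn_wge0 // mulr_ge0 ?exprn_ge0 // subr_ge0.
rewrite ge0 /=; have [km|mk] := leqP k m; last by rewrite /bern bin_small // mulr0n horner0 ler01.
have kS : (k < m.+1)%N by [].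
have := congr1 (fun p : {poly R} => p.[t]) (bern_sum R m); rewrite /= hornerE horner_sum => <-.
rewrite (bigD1 (Ordinal kS)) //= lerDl; exact: sumr_ge0.
Qed.

(** The Bernstein polynomial of degree [2 n + 1] and index 1 is at most 1 at [u^2]. *)
Lemma sqr_pow_le (R : realType) n (u : R) : `|u| <= 1 ->
  (`|u| * (1 - u ^+ 2) ^+ n) ^+ 2 <= (n.*2.+1)%:R^-1.
Proof.
move=> u1; have u2 : 0 <= u ^+ 2 <= 1.
  by rewrite sqr_ge0 -real_normK ?num_real // expr_le1.
have /andP[_] := bern_le1 n.*2.+1 1 u2.
rewrite /bern hornerMn hornerM !horner_exp !hornerE bin1 subn1 /=.
rewrite -[_ *+ n.*2.+1]mulr_natr => h.
rewrite exprMn real_normK ?num_real // -exprM muln2 -div1r ler_pdivlMr ?ltr0n //.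
by rewrite [u ^+ 2 * _]mulrC [u ^+ 2 as X in _ * X]expr2 mulrA.
Qed.

Lemma damp_small (R : realType) (d : R) : 0 < d -> exists n,
  forall t, 0 <= t <= 1 -> `|2 * t - 1| * (damp R n).[t] <= d.
Proof.
move=> d0; pose n := Num.bound (d ^- 2); exists n => t t01.
have hn : (n.*2.+1)%:R^-1 <= d ^+ 2.
  rewrite -[leRHS]invrK lef_pV2 ?posrE ?invr_gt0 ?exprn_gt0 ?ltr0n //.
  apply: (@le_trans _ _ n%:R); last by rewrite ler_nat -addnn; lia.
  by rewrite ltW // archi_boundP // invr_ge0 exprn_ge0 // ltW.
have /andP[q0 q1] := damp01 n t01.
rewrite -(@ler_pXn2r _ 2) ?nnegrE ?(ltW d0) ?mulr_ge0 // damp_horner.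
exact: le_trans (sqr_pow_le _ (polyY_norm t01)) hn.
Qed.

Section ApproximateUnit.
Variables (R : realType) (A : cstarAlgType R).
Implicit Types x y z : A.

(** [E] plays the role of left multiplication by [1 - v], with [v] an approximate unit of [J]; it is
    [(1 - s^2)^n] for a rescaling [s] of [y]. *)
Lemma approx_unit (J : ideal A) y (e : R) : cstar y = y -> ideal_set J y -> 0 < e ->
  exists E : A -> A, [/\ forall x z, E (x + z) = E x + E z,
    forall x, rn (E x) <= rn x, forall x z, E (x ** z) = E x ** z,
    forall x, ideal_set J (x - E x) & rn (E y) <= e].
Proof.
move=> y_sa Jy e0; pose c := rn y + 1; have c0 : 0 < c by rewrite ltr_wpDl ?rn_ge0.
pose s := c^-1%:C%C *: y.
have s_sa : cstar s = s by rewrite cstarZ y_sa; congr (_ *: _); exact: conjc_real.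
have s1 : rn s <= 1.
  by rewrite rnZr ger0_norm ?invr_ge0 ?(ltW c0) // mulrC ler_pdivrMr // mul1r lerDl.
have yE : y = c%:C%C *: s.
  by rewrite scalerA -rmorphM divff ?gt_eqF // scale1r.
pose d := e / c; have d0 : 0 < d by rewrite divr_gt0.
have [n hn] := damp_small d0.
pose H := element_op s_sa s1; pose q := damp R n.
have bq : rbnd H q 1.
  by apply: rbnd_sup => t /(damp01 n)/andP[h0 h1]; rewrite ger0_norm.
have bYq : rbnd H (polyY R * q) d.
  apply: rbnd_sup => t t01; have /andP[q0 _] := damp01 n t01.
  by rewrite hornerM polyY_horner normrM [`|q.[t]|]ger0_norm ?hn.
exists (ract H q); split=> [x z|x|x z|x|].
- exact: ractDr.
- by rewrite -[leRHS]mul1r; exact: bq.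
- exact: ract_amul.
- rewrite -{1}(ract1 H x) -ractB.
  have [g ->] := one_sub_damp R n.
  rewrite ractM ract_polyY; apply: idealMr; exact: idealZ.
rewrite yE ractZr rnZr gtr0_norm // mulrC -ler_pdivlMr // -/d.
have [->|r0] := eqVneq (rn (ract H q s)) 0; first exact: ltW.
have rp : 0 < rn (ract H q s) by rewrite lt_neqAle eq_sym r0 rn_ge0.
(* [s] need not be [polyY] applied to an element of [A], so the bound on [polyY * q] does not apply
   to [q] acting on [s]. The C*-identity supplies the missing factor, at the price of a square. *)
rewrite -(ler_pM2r rp) -expr2 -rn_cstarM cstar_ract s_sa.
by rewrite -(ract_polyY s_sa s1) -!ractM mulrA ractM; exact: bYq.
Qed.

End ApproximateUnit.

(** * Quotient norms *)

Section Distance.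
Variables (R : realType) (A : cstarAlgType R) (J : ideal A).
Implicit Types x y z u : A.

Lemma approx_unit_mul x (e : R) : 0 < e -> ideal_set J (x ** cstar x) ->
  exists E : A -> A, [/\ forall x z, E (x + z) = E x + E z,
    forall x, rn (E x) <= rn x, forall x z, E (x ** z) = E x ** z,
    forall x, ideal_set J (x - E x) & rn (E x) <= e].
Proof.
move=> e0 Jx; have [|E [ED E1 EM EJ Es]] := @approx_unit _ _ J _ _ _ Jx (exprn_gt0 2 e0).
  by rewrite cstarM cstarK.
exists E; split=> //; rewrite -(@ler_pXn2r _ 2) ?nnegrE ?rn_ge0 ?(ltW e0) //.
rewrite -rn_mulcstar -EM (_ : x ** cstar (E x) = cstar (E (x ** cstar x))); last first.
  by rewrite EM cstarM cstarK.
by apply: le_trans (E1 _) _; rewrite rn_cstar.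
Qed.

(** As [cstar x ** x] lies in [J], the elements [cstar x - E (cstar x)] of [J] come arbitrarily
    close to [cstar x]. *)
Lemma ideal_cstar x : ideal_set J x -> ideal_set J (cstar x).
Proof.
move=> Jx; apply: (closed_rnP (ideal_set J)).1 (@ideal_closed _ _ J) _ _ => e e0.
have e2 : 0 < e / 2 by rewrite divr_gt0.
have [|E [_ _ _ EJ Ex]] := @approx_unit_mul (cstar x) _ e2.
  by rewrite cstarK; apply: idealMl.
exists (cstar x - E (cstar x)) => //.
rewrite opprB addrC subrK; apply: le_lt_trans Ex _.
by rewrite ltr_pdivrMr // ltr_pMr // ltr1n.
Qed.

Definition dist x : R := inf [set rn (x - y) | y in ideal_set J].

Lemma dist_has_inf x : has_inf [set rn (x - y) | y in ideal_set J].
Proof.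
split; first by exists (rn (x - 0)), 0; [exact: ideal0|].
by exists 0 => _ [y _ <-]; exact: rn_ge0.
Qed.

Lemma dist_le x y : ideal_set J y -> dist x <= rn (x - y).
Proof. by move=> Jy; apply: ge_inf; [exact: (dist_has_inf x).2|exists y]. Qed.

Lemma dist_le_rn x : dist x <= rn x.
Proof. by rewrite -[in leRHS](subr0 x); apply: dist_le; exact: ideal0. Qed.

Lemma dist_lt x e : dist x < e -> exists2 y, ideal_set J y & rn (x - y) < e.
Proof.
rewrite -subr_gt0 => e0; have [_ [y Jy <-]] := inf_adherent e0 (dist_has_inf x).
by rewrite -/(dist x) [dist x + _]addrC subrK => h; exists y.
Qed.

Lemma dist_ge0 x : 0 <= dist x.
Proof.
apply: lb_le_inf; first exact: (dist_has_inf x).1.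
by move=> _ [y _ <-]; exact: rn_ge0.
Qed.

Lemma dist_leP x e : (forall d, 0 < d -> exists2 y, ideal_set J y & rn (x - y) <= e + d) -> dist x <= e.
Proof.
move=> h; apply/ler_addgt0Pr => d /h[y Jy]; apply: le_trans; exact: dist_le.
Qed.

Lemma dist_approx x d : 0 < d -> exists2 y, ideal_set J y & rn (x - y) <= dist x + d.
Proof.
move=> d0; have [|y Jy h] := @dist_lt x (dist x + d); first by rewrite ltrDl.
by exists y => //; exact: ltW.
Qed.

Lemma distD x y : dist (x + y) <= dist x + dist y.
Proof.
apply: dist_leP => d d0; have d2 : 0 < d / 2 by rewrite divr_gt0.
have [u Ju hu] := dist_approx x d2; have [v Jv hv] := dist_approx y d2.
exists (u + v); first exact: idealD.
rewrite opprD addrACA; apply: le_trans (rnD _ _) _.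
by rewrite [d]splitr addrACA lerD.
Qed.

Lemma dist_ideal x : ideal_set J x -> dist x = 0.
Proof.
move=> Jx; apply/eqP; rewrite eq_le dist_ge0 andbT.
by rewrite (le_trans (dist_le x Jx)) // subrr rn0.
Qed.

Lemma dist_congr x y : ideal_set J (x - y) -> dist x = dist y.
Proof.
suff le u v : ideal_set J (u - v) -> dist u <= dist v.
  move=> Jxy; apply/eqP; rewrite eq_le !le // -opprB; exact: idealN.
move=> Juv; rewrite -[u](subrK v) (le_trans (distD _ _)) //.
by rewrite dist_ideal // add0r.
Qed.

Lemma dist_eq0 x : dist x <= 0 -> ideal_set J x.
Proof.
move=> x0; apply: (closed_rnP (ideal_set J)).1 (@ideal_closed _ _ J) _ _ => e e0.
by apply: dist_lt; exact: le_lt_trans e0.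
Qed.

Lemma distZ k x : dist (k *: x) <= complex.Re `|k| * dist x.
Proof.
apply: dist_leP => d d0; set c := complex.Re `|k|.
have c0 : 0 <= c by rewrite /c -ler0c RRe_real // ger0_real.
have c1 : 0 < c + 1 by rewrite ltr_wpDl.
have [y Jy hy] := dist_approx x (divr_gt0 d0 c1).
exists (k *: y); first exact: idealZ.
rewrite -scalerBr rnZ -/c (le_trans (ler_wpM2l c0 hy)) // mulrDr lerD2l.
by rewrite mulrA ler_pdivrMr // mulrC ler_pM2l // lerDl.
Qed.

Lemma distN x : dist (- x) = dist x.
Proof.
suff le u : dist (- u) <= dist u.
  by apply/eqP; rewrite eq_le le -{1}(opprK x) le.
by have := distZ (-1) u; rewrite scaleN1r normrN1 mul1r.
Qed.

Lemma distB x y : dist (x - y) <= dist x + dist y.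
Proof. by rewrite -(distN y) distD. Qed.

Lemma distM x y : dist (x ** y) <= dist x * dist y.
Proof.
apply: dist_leP => d d0; pose c := dist x + dist y + 1.
have c1 : 1 <= c by rewrite lerDr addr_ge0 // dist_ge0.
pose e := Num.min 1 (d / c).
have e0 : 0 < e by rewrite lt_min ltr01 divr_gt0 // (lt_le_trans _ c1).
have e1 : e <= 1 by rewrite ge_min lexx.
have ec : e * c <= d by rewrite -ler_pdivlMr ?ge_min ?lexx ?orbT // (lt_le_trans _ c1).
have [u Ju hu] := dist_approx x e0; have [v Jv hv] := dist_approx y e0.
exists (x ** v + u ** y - u ** v).
  apply: idealB; last exact: idealMr.
  by apply: idealD; [exact: idealMl|exact: idealMr].
have -> : x ** y - (x ** v + u ** y - u ** v) = (x - u) ** (y - v).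
  by rewrite amulBl !amulBr !opprD !opprK !addrA.
apply: le_trans (rnM _ _) _.
have x0 := dist_ge0 x; have y0 := dist_ge0 y.
apply: (@le_trans _ _ ((dist x + e) * (dist y + e))).
  by rewrite ler_pM ?rn_ge0.
rewrite /c in ec; nra.
Qed.

(** Let [j] in [J] nearly realize the distance of [x ** cstar x], and let [E] nearly kill [j]. Then
    [E x] is congruent to [x], and its squared norm is at most that of [E (x ** cstar x)], which is
    close to [E (x ** cstar x - j)]. *)
Lemma dist_mulcstar x : dist x ^+ 2 <= dist (x ** cstar x).
Proof.
apply/ler_addgt0Pr => d d0; have d2 : 0 < d / 2 by rewrite divr_gt0.
have [j Jj hj] := dist_approx (x ** cstar x) d2.
have [|E [ED E1 EM EJ Ex]] := @approx_unit_mul j _ d2; first exact: idealMr.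
have dE : dist x <= rn (E x).
  by have := dist_le x (EJ x); rewrite opprB addrC subrK.
have xE : rn (E x) ^+ 2 <= rn (E (x ** cstar x)).
  rewrite -rn_mulcstar -EM (_ : x ** cstar (E x) = cstar (E (x ** cstar x))); last first.
    by rewrite EM cstarM cstarK.
  by apply: le_trans (E1 _) _; rewrite rn_cstar.
apply: (@le_trans _ _ (rn (E x) ^+ 2)).
  by rewrite lerXn2r ?nnegrE ?dist_ge0 ?rn_ge0.
apply: le_trans xE _; rewrite -{1}[x ** _](subrK j) ED.
apply: le_trans (rnD _ _) _; rewrite [d]splitr addrA lerD //.
exact: le_trans (E1 _) hj.
Qed.

Lemma dist_cstar x : dist (cstar x) = dist x.
Proof.
suff le u : dist (cstar u) <= dist u.
  by apply/eqP; rewrite eq_le le -{1}(cstarK x) le.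
apply: dist_leP => d d0; have [y Jy hy] := dist_approx u d0.
exists (cstar y); first exact: ideal_cstar.
by rewrite -cstarB rn_cstar.
Qed.

Lemma dist_cstarmul x : dist x ^+ 2 <= dist (cstar x ** x).
Proof. by rewrite -{1}(cstarK x) dist_cstar -{3}(cstarK x) dist_mulcstar. Qed.

Lemma ideal_faithful u : (forall y, ideal_set J (u ** y)) -> ideal_set J u.
Proof.
move=> h; apply: dist_eq0; have := dist_mulcstar u.
rewrite (dist_ideal (h _)) => /(le_trans _) h0.
by rewrite -(@ler_pXn2r _ 2) ?nnegrE ?dist_ge0 // expr0n h0.
Qed.

End Distance.

(** * Gluing along a cutoff *)

Section Glue.
Variables (R : realType) (A : cstarAlgType R) (J : ideal A) (s : A).
Hypotheses (s_sa : cstar s = s) (s_le1 : rn s <= 1).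
Hypothesis s_centr : forall x, ideal_set J (s ** x - x ** s).
Implicit Types (x y z : A) (p : {poly R}).

Local Notation H := (element_op s_sa s_le1).

(** Selfadjointness of [ract H p] is known only through products, so membership in [J] is tested by
    multiplying with every [y]. *)
Lemma cstar_ract_centr p x :
  ideal_set J (cstar (ract H p x) - ract H p (cstar x)).
Proof.
apply: ideal_faithful => y; rewrite amulBl cstar_ract -ract_amul.
exact: ract_centr.
Qed.

Section TwoPieces.
Variables (p : {poly R}) (d : R).
Hypothesis p01 : forall t, 0 <= t <= 1 -> 0 <= p.[t] <= 1.
Hypothesis d_ge0 : 0 <= d.

Definition glued (r1 r2 x : A) := [/\ rn r1 <= d, rn r2 <= d &
  ideal_set J (x - (ract H p r1 + ract H (1 - p) r2))].

(* The span in which products of [m] glued elements live: its distance bound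
   exceeds [d^m] only by a factor linear in [m], which disappears on taking
   [2^r]-th powers in [dist_glued]. *)
Definition bern_span (m : nat) (x : A) := exists2 w : nat -> A,
  forall k, (k <= m)%N -> rn (w k) <= d ^+ m &
  ideal_set J (x - \sum_(k < m.+1) ract H (bern R m k \Po p) (w k)).

Lemma bern_span_dist m x : bern_span m x -> dist J x <= m.+1%:R * d ^+ m.
Proof.
case=> w hw /dist_congr ->; apply: le_trans (dist_le_rn _ _) _.
apply: le_trans (rn_sum _ _ _) _.
have -> : m.+1%:R * d ^+ m = \sum_(k < m.+1) d ^+ m.
  by rewrite sumr_const card_ord mulr_natl.
apply: ler_sum => k _; have kb : rbnd H (bern R m k \Po p) 1.
  apply: rbnd_sup => t t01; rewrite horner_comp.
  by have /andP[b0 b1] := bern_le1 m k (p01 t01); rewrite ger0_norm.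
by apply: le_trans (kb _) _; rewrite mul1r hw // -ltnS.
Qed.

Lemma bern_span1 r1 r2 x : glued r1 r2 x -> bern_span 1 x.
Proof.
(* Index 0 carries [r2], since [bern 1 0] is [1 - X]. *)
case=> h1 h2 hx; exists (fun k => if k is 0 then r2 else r1) => [[|k] _|].
- by rewrite expr1.
- by rewrite expr1.
rewrite big_ord_recl big_ord1 /= /bern subn0 subnn !expr0 !expr1 mulr1 mul1r.
rewrite bin0 bin1 !mulr1n comp_polyX comp_polyB comp_polyX comp_polyC.
by rewrite polyC1 [_ + ract H p r1]addrC.
Qed.

(** Raising the degree by [bern_mulX] and [bern_mul1X] makes each new coefficient a convex
    combination of [r1 ** w (j - 1)] and [r2 ** w j], so the bound is multiplied by exactly [d]. *)
Lemma bern_spanM r1 r2 x m y : glued r1 r2 x -> bern_span m y ->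
  bern_span m.+1 (x ** y).
Proof.
case=> h1 h2 hx [w hw hy].
pose c (j : nat) : R := j%:R / m.+1%:R.
pose w' j := (c j)%:C%C *: (r1 ** w j.-1) + (1 - c j)%:C%C *: (r2 ** w j).
exists w' => [j jm|].
  have c01 : 0 <= c j <= 1.
    by rewrite divr_ge0 //= ler_pdivrMr ?ltr0n // mul1r ler_nat.
  have c1 : 0 <= 1 - c j by rewrite subr_ge0; case/andP: c01.
  have c0 : 0 <= c j by case/andP: c01.
  apply: le_trans (rnD _ _) _; rewrite !rnZr !ger0_norm //.
  have le_d r k : (k <= m)%N -> rn r <= d -> rn (r ** w k) <= d ^+ m.+1.
    by move=> km hr; apply: le_trans (rnM _ _) _; rewrite exprS ler_pM ?rn_ge0 ?hw.
  have -> : d ^+ m.+1 = c j * d ^+ m.+1 + (1 - c j) * d ^+ m.+1.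
    by rewrite -mulrDl addrC subrK mul1r.
  apply: lerD.
    by rewrite ler_wpM2l // le_d // -ltnS; case: (j) jm.
  (* Here [w j] is out of range, but its weight is zero. *)
  have [->|jm'] := eqVneq j m.+1.
    by rewrite /c divff ?pnatr_eq0 // subrr !mul0r.
  by rewrite ler_wpM2l // le_d // -ltnS ltn_neqAle jm' jm.
have E : \sum_(j < m.+2) ract H (bern R m.+1 j \Po p) (w' j) =
    \sum_(k < m.+1) (ract H ((p * (bern R m k \Po p))) (r1 ** w k) +
      ract H ((1 - p) * (bern R m k \Po p)) (r2 ** w k)).
  under eq_bigr do rewrite /w' ractDr !ractZr -!ractZ -!comp_polyZ.
  rewrite !big_split /=; congr (_ + _).
    rewrite big_ord_recl [X in X + _](_ : _ = 0) ?add0r; last first.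
      by rewrite /= /c mul0r scale0r comp_poly0 /ract rmorph0 act0.
    apply: eq_bigr => k _; rewrite lift0 bern_mulX /=.
    by rewrite comp_polyM comp_polyX.
  rewrite big_ord_recr [X in _ + X = _](_ : _ = 0) ?addr0; last first.
    by rewrite /= /c divff ?pnatr_eq0 // subrr scale0r comp_poly0 /ract rmorph0 act0.
  apply: eq_bigr => k _.
  by rewrite bern_mul1X comp_polyM comp_polyB comp_polyX comp_polyC polyC1.
rewrite E; set Y := \sum_(k < m.+1) ract H _ (w k) in hy.
rewrite -[X in ideal_set J X](subrKA (x ** Y)) -amulBr.
apply: idealD; first exact: idealMl.
have SJ (F : 'I_m.+1 -> A) : (forall k, ideal_set J (F k)) -> ideal_set J (\sum_k F k).
  by move=> hF; elim/big_ind: _ => // [|u v]; [exact: ideal0|exact: idealD].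
rewrite /Y (big_morph (amul x) (fun u v => amulDr x u v) (amul0r x)) -sumrB.
apply: SJ => k; set q := bern R m k \Po p.
rewrite -[X in ideal_set J X](subrKA (ract H q (x ** w k))).
apply: idealD; first exact: ract_centr.
have -> : ract H (p * q) (r1 ** w k) + ract H ((1 - p) * q) (r2 ** w k) =
    ract H q ((ract H p r1 + ract H (1 - p) r2) ** w k).
  by rewrite amulDl -!ract_amul ractDr -!ractM ![q * _]mulrC.
by rewrite -ractBr -amulBl; apply: ideal_ract; exact: idealMr.
Qed.

Lemma glued_cstar r1 r2 x : glued r1 r2 x -> glued (cstar r1) (cstar r2) (cstar x).
Proof.
case=> h1 h2 hx; split; rewrite ?rn_cstar //.
have := ideal_cstar hx; rewrite cstarB cstarD => h.
set u := ract H p r1 in h; set v := ract H (1 - p) r2 in h.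
rewrite -[X in ideal_set J X](subrKA (cstar u + cstar v)); apply: idealD => //.
by rewrite opprD addrACA; apply: idealD; exact: cstar_ract_centr.
Qed.

(** The C*-identity modulo [J] bounds the [2^r]-th power of [dist J u] by the distance of the
    [2^r]-th power of [u], an element of a Bernstein span of degree [2 * 2^r]. *)
Lemma dist_glued r1 r2 x : glued r1 r2 x -> dist J x <= d.
Proof.
move=> gx; pose u := cstar x ** x.
(* Without a unit the iteration starts at [u]: [pw n] is the power of exponent [n + 1]. *)
pose pw n := iter n (fun z => u ** z) u.
have pwM m n : pw m ** pw n = pw (m + n).+1.
  by elim: m => [|m IH] //=; rewrite -amulA IH.
have u_sa : cstar u = u by rewrite cstarM cstarK.
have pw_comm n : u ** pw n = pw n ** u.
  by elim: n => [|n IH] //=; rewrite IH amulA IH.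
have pw_sa n : cstar (pw n) = pw n.
  by elim: n => [|n IH] //=; rewrite cstarM IH u_sa pw_comm.
have pw_span n : bern_span n.+1.*2 (pw n).
  elim: n => [|n IH]; first exact: bern_spanM (glued_cstar gx) (bern_span1 gx).
  rewrite doubleS /= /u -amulA.
  exact: bern_spanM (glued_cstar gx) (bern_spanM gx IH).
have pw_dist r : dist J u ^+ (2 ^ r) <= dist J (pw (2 ^ r).-1).
  elim: r => [|r IH]; first by rewrite expn0 expr1.
  rewrite expnS mulnC exprM.
  apply: (@le_trans _ _ (dist J (pw (2 ^ r).-1) ^+ 2)).
    by rewrite lerXn2r ?nnegrE ?exprn_ge0 ?dist_ge0.
  apply: le_trans (dist_mulcstar _ _) _; rewrite pw_sa pwM.
  suff -> : ((2 ^ r).-1 + (2 ^ r).-1).+1 = (2 ^ r * 2).-1 by [].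
  by have := expn_gt0 2 r; lia.
suff : dist J u <= d ^+ 2.
  move=> h; rewrite -(@ler_pXn2r _ 2) ?nnegrE ?dist_ge0 //.
  exact: le_trans (dist_cstarmul _ _) h.
(* The constants come from the number [2 * 2^r + 1] of terms in the span. *)
apply: (@pow2_growth_le _ _ _ 2 1); rewrite ?dist_ge0 ?exprn_ge0 // => r.
apply: le_trans (pw_dist r) _; apply: le_trans (bern_span_dist (pw_span _)) _.
rewrite prednK ?expn_gt0 // -exprM mul2n.
by rewrite -natr1 -muln2 natrM [_ * 2]mulrC.
Qed.

End TwoPieces.

(** That no factor is lost is what makes glued approximants contradict maximality and keeps balls of
    the centre stable under gluing. *)
Lemma dist_glue p d r1 r2 : (forall t, 0 <= t <= 1 -> 0 <= p.[t] <= 1) ->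
  rn r1 <= d -> rn r2 <= d -> dist J (ract H p r1 + ract H (1 - p) r2) <= d.
Proof.
move=> p01 h1 h2; have d0 := le_trans (rn_ge0 _) h1.
apply: (dist_glued p01 d0 (r1 := r1) (r2 := r2)); split=> //.
by rewrite subrr; exact: ideal0.
Qed.

End Glue.

Section ZeroIdeal.
Variables (R : realType) (A : cstarAlgType R).

Lemma zero_ideal_closed : closed [set 0 : A].
Proof.
apply/closed_rnP => x h; apply: rn_eq0; apply/eqP; rewrite eq_le rn_ge0 andbT.
by apply/ler_addgt0Pl => e /h[_ -> ]; rewrite subr0 addr0 => /ltW.
Qed.

Lemma zero_idealD x y : [set 0 : A] x -> [set 0 : A] y -> [set 0 : A] (x + y).
Proof. by move=> -> ->; rewrite /= addr0. Qed.

Lemma zero_idealZ k x : [set 0 : A] x -> [set 0 : A] (k *: x).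
Proof. by move=> ->; rewrite /= scaler0. Qed.

Lemma zero_idealMl x y : [set 0 : A] y -> [set 0 : A] (x ** y).
Proof. by move=> ->; rewrite /= amul0r. Qed.

Lemma zero_idealMr x y : [set 0 : A] x -> [set 0 : A] (x ** y).
Proof. by move=> ->; rewrite /= amul0l. Qed.

(** Modulo this ideal the gluing estimate is a norm bound in [A], valid for central [s]. *)
Definition zero_ideal : ideal A := Ideal erefl zero_idealD zero_idealZ
  zero_idealMl zero_idealMr zero_ideal_closed.

Lemma dist_zero_ideal x : dist zero_ideal x = rn x.
Proof.
apply/eqP; rewrite eq_le dist_le_rn /=; apply/ler_addgt0Pr => d d0.
have [_ -> ] := dist_approx zero_ideal x d0; rewrite subr0 => h.
exact: le_trans h _.
Qed.

End ZeroIdeal.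

(** * Ideals of elements supported on one side of a point *)

Section SignApproximation.
Variable R : realType.

(* [t * sgnp k] is the classical iteration [v + (t^2 - v^2) / 2] for [|t|], so
   [sgnp k] approximates the sign of [t]. *)
Fixpoint sgnp (k : nat) : {poly R} :=
  if k is k'.+1 then sgnp k' + 2^-1 *: ('X * (1 - sgnp k' ^+ 2)) else 0.

Definition eps (k : nat) : R := 2 / k.+1%:R.

Lemma eps_gt0 k : 0 < eps k.
Proof. by rewrite divr_gt0 ?ltr0n. Qed.

Lemma eps_antitone m n : (m <= n)%N -> eps n <= eps m.
Proof. by move=> mn; rewrite ler_pM2l // lef_pV2 ?posrE ?ltr0n // ler_nat. Qed.

Lemma eps_lt (e : R) : 0 < e -> exists k, eps k < e.
Proof.
move=> e0; exists (Num.bound (2 / e)); set N := Num.bound _.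
rewrite ltr_pdivrMr ?ltr0n // mulrC -ltr_pdivrMr //.
apply: (@lt_trans _ _ N%:R); last by rewrite ltr_nat.
by rewrite archi_boundP // divr_ge0 // ltW.
Qed.

(** Each step multiplies the error [|t| - t f] by [1 - (|t| + t f) / 2], at most [1 - |t| / 2]. The
    resulting bound [|t| (1 - |t| / 2)^k] is at most [eps k] by the bound on [bern k.+1 1] at
    [|t| / 2]. *)
Lemma sgnp_bound k (t : R) : `|t| <= 1 ->
  `|(sgnp k).[t]| <= 1 /\ `| `|t| - t * (sgnp k).[t] | <= eps k.
Proof.
move=> t1; suff : [/\ `|(sgnp k).[t]| <= 1, 0 <= t * (sgnp k).[t] <= `|t| &
    `|t| - t * (sgnp k).[t] <= `|t| * (1 - `|t| / 2) ^+ k].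
  case=> h1 /andP[_ h2] h3; split=> //; rewrite ger0_norm ?subr_ge0 //; apply: le_trans h3 _.
  have b01 : 0 <= `|t| / 2 <= 1.
    by rewrite divr_ge0 //= ler_pdivrMr // mul1r (le_trans t1) // ler1n.
  have /andP[_] := bern_le1 k.+1 1 b01.
  rewrite /bern hornerMn hornerM !horner_exp !hornerE bin1 subn1 /=.
  rewrite -[_ *+ k.+1]mulr_natr => h.
  rewrite /eps ler_pdivlMr ?ltr0n //; set z := (1 - _) ^+ k in h *.
  have -> : `|t| * z * k.+1%:R = 2 * (z * (`|t| / 2) * k.+1%:R) by field.
  lra.
elim: k => [|k [IH1 /andP[IH0 IH2] IH3]].
  by rewrite horner0 normr0 ler01 mulr0 subr0 normr_ge0 lexx expr0 mulr1; split.
have -> : (sgnp k.+1).[t] = (sgnp k).[t] + t * (1 - (sgnp k).[t] ^+ 2) / 2.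
  by rewrite /= hornerD hornerZ hornerM hornerX hornerD hornerN horner_exp hornerC; ring.
set f := (sgnp k).[t] in IH0 IH1 IH2 IH3 *.
have t0 := normr_ge0 t; set a := `|t| in t0 t1 IH2 IH3 *.
have ta : t * t = a * a by rewrite /a -!expr2 real_normK ?num_real.
have f2 : 0 <= 1 - f ^+ 2 by rewrite subr_ge0 -real_normK ?num_real // expr_le1.
have E : a - t * (f + t * (1 - f ^+ 2) / 2) = (a - t * f) * (1 - (a + t * f) / 2).
  have -> : (a - t * f) * (1 - (a + t * f) / 2) = a - t * f - (a * a - t * t * f ^+ 2) / 2.
    by field.
  by rewrite -ta; field.
split.
- have : `|f| + (1 - `|f| ^+ 2) / 2 <= 1.
    rewrite -subr_ge0 (_ : _ - _ = (1 - `|f|) ^+ 2 / 2); last by field.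
    by rewrite divr_ge0 // sqr_ge0.
  apply: le_trans; apply: le_trans (ler_normD _ _) _; rewrite lerD2l.
  rewrite !normrM (real_normK (num_real f)) (ger0_norm f2) [`|2^-1|]ger0_norm ?invr_ge0 //.
  by rewrite ler_wpM2r ?invr_ge0 // ler_piMl.
- apply/andP; split; last by rewrite -subr_ge0 E mulr_ge0 ?subr_ge0 //; lra.
  rewrite mulrDr addr_ge0 // mulrA mulrA ta.
  by rewrite !mulr_ge0 ?invr_ge0.
rewrite E exprSr mulrA ler_pM ?subr_ge0 //; lra.
Qed.

End SignApproximation.

Section SideIdeals.
Variables (R : realType) (A : cstarAlgType R) (J : ideal A) (s : A).
Hypotheses (s_sa : cstar s = s) (s_le1 : rn s <= 1).
Hypothesis s_centr : forall x, ideal_set J (s ** x - x ** s).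
Variables (l sg : R).
Hypotheses (l01 : 0 <= l <= 1) (sg2 : sg * sg = 1).
Implicit Types (x y z : A).

Local Notation H := (element_op s_sa s_le1).

Definition shifted : {poly R} := 'X - l%:P.

Definition shifted_sgn k : {poly R} := sgnp R k \Po shifted.

Definition cutoff k : {poly R} := 2^-1 *: (1 + sg *: shifted_sgn k).

Lemma shifted_norm (t : R) : 0 <= t <= 1 -> `|t - l| <= 1.
Proof. by case/andP=> t0 t1; case/andP: l01 => l0 l1; rewrite ler_norml; lra. Qed.

Lemma shifted_horner t : shifted.[t] = t - l.
Proof. by rewrite /shifted !hornerE. Qed.

Lemma shifted_sgn_horner k t : (shifted_sgn k).[t] = (sgnp R k).[t - l].
Proof. by rewrite horner_comp shifted_horner. Qed.

Lemma cutoff_horner k t : (cutoff k).[t] = 2^-1 * (1 + sg * (sgnp R k).[t - l]).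
Proof. by rewrite /cutoff !(hornerE, shifted_sgn_horner). Qed.

Lemma sg_norm : `|sg| = 1.
Proof.
have : `|sg| ^+ 2 = 1 by rewrite real_normK ?num_real // expr2.
by move/eqP; rewrite pexpr_eq1 // => /eqP.
Qed.

Lemma cutoff01 k t : 0 <= t <= 1 -> 0 <= (cutoff k).[t] <= 1.
Proof.
move=> /shifted_norm /(sgnp_bound k) [h _]; rewrite cutoff_horner.
have : `|sg * (sgnp R k).[t - l]| <= 1 by rewrite normrM sg_norm mul1r.
by rewrite ler_norml; lra.
Qed.

Lemma rbnd_cutoff k : rbnd H (cutoff k) 1.
Proof.
by apply: rbnd_sup => t /(cutoff01 k) /andP[h0 h1]; rewrite ger0_norm.
Qed.

(* Elements supported, modulo [J], on the spectrum of [s] (transported to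
   [[0, 1]]) on one side of [l]: to the left for [sg = 1], to the right for
   [sg = -1]. *)
Definition side_set : set A := [set x | forall e : R, 0 < e ->
  exists K : nat, forall k, (K <= k)%N -> dist J (ract H (cutoff k) x) <= e].

Lemma sub_side_set x : ideal_set J x -> side_set x.
Proof.
move=> Jx e e0; exists 0%N => k _; rewrite dist_ideal ?(ltW e0) //.
exact: ideal_ract.
Qed.

Lemma side_setD x y : side_set x -> side_set y -> side_set (x + y).
Proof.
move=> hx hy e e0; have e2 : 0 < e / 2 by rewrite divr_gt0.
have [K hK] := hx _ e2; have [L hL] := hy _ e2.
exists (maxn K L) => k; rewrite geq_max => /andP[Kk Lk].
rewrite ractDr (le_trans (distD _ _ _)) // [e]splitr lerD //; first exact: hK.
exact: hL.
Qed.

Lemma side_set_scaled x y (c : R) : 0 <= c -> side_set x ->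
  (forall k, dist J (ract H (cutoff k) y) <= c * dist J (ract H (cutoff k) x)) ->
  side_set y.
Proof.
move=> c0 hx h e e0; have c1 : 0 < c + 1 by rewrite ltr_wpDl.
have [K hK] := hx _ (divr_gt0 e0 c1); exists K => k /hK hk.
apply: le_trans (h k) _; apply: le_trans (ler_wpM2l c0 hk) _.
by rewrite mulrA ler_pdivrMr // mulrC ler_pM2l // lerDl.
Qed.

Lemma Re_norm_ge0 (k : R[i]) : 0 <= complex.Re `|k|.
Proof. by rewrite -ler0c RRe_real // ger0_real. Qed.

Lemma side_setZ k x : side_set x -> side_set (k *: x).
Proof.
move=> hx; apply: (side_set_scaled (Re_norm_ge0 k) hx) => n.
by rewrite ractZr; exact: distZ.
Qed.

Lemma side_setMl x y : side_set y -> side_set (x ** y).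
Proof.
move=> hy; apply: (side_set_scaled (dist_ge0 J x) hy) => n.
rewrite -(dist_congr (ract_centr s_sa s_le1 s_centr (cutoff n) y x)).
exact: distM.
Qed.

Lemma side_setMr x y : side_set x -> side_set (x ** y).
Proof.
move=> hx; apply: (side_set_scaled (dist_ge0 J y) hx) => n.
by rewrite ract_amul mulrC; exact: distM.
Qed.

Lemma side_set_closed : closed side_set.
Proof.
apply/closed_rnP => x h e e0; have e2 : 0 < e / 2 by rewrite divr_gt0.
have [y hy xy] := h _ e2; have [K hK] := hy _ e2; exists K => k /hK hk.
rewrite -[x](subrK y) ractDr (le_trans (distD _ _ _)) // [e]splitr lerD //.
apply: le_trans (dist_le_rn _ _) _; apply: le_trans (rbnd_cutoff k _) _.
by rewrite mul1r ltW.
Qed.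

Definition side : ideal A := Ideal (sub_side_set (ideal0 J)) side_setD side_setZ
  side_setMl side_setMr side_set_closed.

(** The [u n] converge to [|X - l| - sg (X - l)] applied to [x]. This function vanishes where
    [sg (t - l)] is nonnegative, so the limit is in the side ideal, hence in [J]. *)
Lemma side_trivial x k : side_set `<=` ideal_set J ->
  dist J (ract H (shifted * shifted_sgn k - sg *: shifted) x) <= 2 * eps R k * rn x.
Proof.
move=> sub; pose u n := ract H (shifted * shifted_sgn n - sg *: shifted) x.
have u_cauchy m n : (m <= n)%N -> rn (u n - u m) <= 2 * eps R m * rn x.
  move=> mn; rewrite /u -ractB; apply: rbnd_sup => t /shifted_norm h.
  have [_ hm] := sgnp_bound m h; have [_ hn] := sgnp_bound n h.
  have le_e := eps_antitone R mn.
  rewrite !(shifted_horner, shifted_sgn_horner, hornerD, hornerN, hornerM, hornerZ).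
  set fm := (sgnp R m).[t - l] in hm *; set fn := (sgnp R n).[t - l] in hn *.
  have -> : (t - l) * fn - sg * (t - l) - ((t - l) * fm - sg * (t - l)) =
    (`|t - l| - (t - l) * fm) - (`|t - l| - (t - l) * fn) by ring.
  apply: le_trans (ler_normB _ _) _; lra.
have [|y hy] := complete_rn u_cauchy.
  move=> e e0; have x1 : 0 < 2 * rn x + 1 by rewrite ltr_wpDl // mulr_ge0 ?rn_ge0.
  have [n hn] := eps_lt (divr_gt0 e0 x1); exists n.
  have := eps_gt0 R n; rewrite ltr_pdivlMr // in hn; nra.
have y_side : side_set y.
  move=> e e0; have x1 : 0 < 3 * rn x + 1 by rewrite ltr_wpDl // mulr_ge0 ?rn_ge0.
  have [K hK] := eps_lt (divr_gt0 e0 x1); exists K => m Km.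
  apply: le_trans (dist_le_rn _ _) _; rewrite -[y](subrK (u m)) ractDr.
  apply: le_trans (rnD _ _) _.
  have h1 : rn (ract H (cutoff m) (y - u m)) <= 2 * eps R m * rn x.
    by apply: le_trans (rbnd_cutoff m _) _; rewrite mul1r.
  (* Since [sg^2 = 1], the product equals [- sg (t - l) (1 - f^2) / 2]; it is small because
     [|t - l| (1 - |f|)] is at most the error of [sgnp]. *)
  have h2 : rn (ract H (cutoff m) (u m)) <= eps R m * rn x.
    rewrite /u -ractM; apply: rbnd_sup => t /shifted_norm h.
    rewrite !(shifted_horner, cutoff_horner, shifted_sgn_horner, hornerD, hornerN, hornerM, hornerZ).
    have [f1] := sgnp_bound m h; set f := (sgnp R m).[t - l] in f1 *.
    apply: le_trans.
    have -> : 2^-1 * (1 + sg * f) * ((t - l) * f - sg * (t - l)) =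
      - (sg * (t - l)) * ((1 - f ^+ 2) / 2).
      apply/eqP; rewrite -subr_eq0; apply/eqP.
      transitivity ((sg * sg - 1) * (- ((t - l) * f) / 2)); first by field.
      by rewrite sg2 subrr mul0r.
    rewrite normrM normrN normrM sg_norm mul1r.
    have -> : `|t - l| * `|(1 - f ^+ 2) / 2| = `|t - l| * (1 - `|f|) * ((1 + `|f|) / 2).
      have f2 : 0 <= 1 - f ^+ 2 by rewrite subr_ge0 -real_normK ?num_real // expr_le1.
      by rewrite [`|_ / 2|]ger0_norm ?divr_ge0 // -(real_normK (num_real f)); field.
    have g0 := normr_ge0 f; have t0 := normr_ge0 (t - l).
    apply: (@le_trans _ _ (`|t - l| * (1 - `|f|))).
      by rewrite ler_piMr ?mulr_ge0 ?subr_ge0 //; lra.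
    by apply: le_trans (ler_norm _); rewrite mulrBr mulr1 lerD2l lerN2 -normrM ler_norm.
  have := eps_antitone R Km; have := rn_ge0 x; rewrite ltr_pdivlMr // in hK.
  have := eps_gt0 R m; nra.
rewrite -[ract _ _ x](subKr y) -/(u k).
apply: le_trans (distB _ _ _) _; rewrite (dist_ideal (sub _ y_side)) add0r.
exact: le_trans (dist_le_rn _ _) (hy k).
Qed.

End SideIdeals.

(** * Ideals maximal among those far from an element *)

Section ChainIdeal.
Variables (R : realType) (A : cstarAlgType R) (C : set (ideal A)) (K0 : ideal A).
Hypotheses (CK0 : C K0)
  (C_total : forall K L, C K -> C L -> ideal_set K `<=` ideal_set L \/ ideal_set L `<=` ideal_set K).
Implicit Types x y : A.

(** The closure of the union of the chain. *)
Definition chain_set : set A := [set x | forall e : R, 0 < e ->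
  exists2 K, C K & exists2 y, ideal_set K y & rn (x - y) < e].

Lemma sub_chain_set K : C K -> ideal_set K `<=` chain_set.
Proof.
by move=> CK x Kx e e0; exists K => //; exists x => //; rewrite subrr rn0.
Qed.

Lemma chain_setD x y : chain_set x -> chain_set y -> chain_set (x + y).
Proof.
move=> hx hy e e0; have e2 : 0 < e / 2 by rewrite divr_gt0.
have [K CK [u Ku xu]] := hx _ e2; have [L CL [v Lv yv]] := hy _ e2.
have uv : rn (x + y - (u + v)) < e.
  rewrite opprD addrACA; apply: le_lt_trans (rnD _ _) _.
  by rewrite [e]splitr ltrD.
by have [KL|LK] := C_total CK CL; [exists L|exists K] => //; exists (u + v) => //;
  apply: idealD => //; [exact: KL|exact: LK].
Qed.

Lemma chain_set_map (f : A -> A) (c : R) x :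
  (forall K : ideal A, forall y, ideal_set K y -> ideal_set K (f y)) ->
  (forall x y, rn (f x - f y) <= c * rn (x - y)) -> 0 <= c ->
  chain_set x -> chain_set (f x).
Proof.
move=> fK fc c0 hx e e0; have c1 : 0 < c + 1 by rewrite ltr_wpDl.
have [K CK [u Ku xu]] := hx _ (divr_gt0 e0 c1).
exists K => //; exists (f u); first exact: fK.
apply: le_lt_trans (fc _ _) _; rewrite ltr_pdivlMr // in xu.
apply: le_lt_trans xu; rewrite mulrC ler_wpM2l ?rn_ge0 // lerDl //.
Qed.

Lemma chain_setZ k x : chain_set x -> chain_set (k *: x).
Proof.
apply: (@chain_set_map (fun x => k *: x) (complex.Re `|k|)) => [K y|y z|].
- exact: idealZ.
- by rewrite -scalerBr rnZ.
- exact: Re_norm_ge0.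
Qed.

Lemma chain_setMl x y : chain_set y -> chain_set (x ** y).
Proof.
apply: (@chain_set_map (fun y => x ** y) (rn x)) => [K z|u v|].
- exact: idealMl.
- by rewrite -amulBr rnM.
- exact: rn_ge0.
Qed.

Lemma chain_setMr x y : chain_set x -> chain_set (x ** y).
Proof.
apply: (@chain_set_map (fun x => x ** y) (rn y)) => [K z|u v|].
- exact: idealMr.
- by rewrite -amulBl mulrC rnM.
- exact: rn_ge0.
Qed.

Lemma chain_set_closed : closed chain_set.
Proof.
apply/closed_rnP => x h e e0; have e2 : 0 < e / 2 by rewrite divr_gt0.
have [y hy xy] := h _ e2; have [K CK [u Ku yu]] := hy _ e2.
exists K => //; exists u => //; rewrite -(subrKA y).
by apply: le_lt_trans (rnD _ _) _; rewrite [e]splitr ltrD.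
Qed.

Definition chain_ideal : ideal A := Ideal (sub_chain_set CK0 (ideal0 K0))
  chain_setD chain_setZ chain_setMl chain_setMr chain_set_closed.

End ChainIdeal.

(** * Maximal far ideals and scalarity *)

Section Far.
Variables (R : realType) (A : cstarAlgType R) (a : A) (W : set A) (d : R).
Implicit Types J K : ideal A.

Definition far J := forall w, W w -> d <= dist J (a - w).

Definition maximal_far J := far J /\
  forall K, ideal_set J `<=` ideal_set K -> far K -> ideal_set K `<=` ideal_set J.

(** Zorn's lemma. The closure of the union of a chain stays far because a distance below [d] would
    already be witnessed by an element of one member. *)
Lemma exists_maximal_far J0 : far J0 ->
  exists2 J, ideal_set J0 `<=` ideal_set J & maximal_far J.
Proof.
move=> far0.
pose T := {J : ideal A | ideal_set J0 `<=` ideal_set J /\ far J}.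
pose le (t u : T) := `[< ideal_set (sval t) `<=` ideal_set (sval u) >].
have [|K L M|C totC|[J [J0J farJ]] Jmax] := @ZL_preorder T (exist _ J0 (conj (fun x => id) far0)) le.
- by move=> K; apply/asboolP.
- by move=> /asboolP KL /asboolP LM; apply/asboolP => x /KL/LM.
- have [[K0 CK0]|C0] := pselect (exists t : T, C t); last first.
    exists (exist _ J0 (conj (fun x => id) far0)) => K CK.
    by case: C0; exists K.
  pose D := [set sval t | t in C].
  have DK0 : D (sval K0) by exists K0.
  have D_total K L : D K -> D L ->
      ideal_set K `<=` ideal_set L \/ ideal_set L `<=` ideal_set K.
    move=> [t Ct <-] [u Cu <-].
    by have [/asboolP h|/asboolP h] := totC _ _ Ct Cu; [left|right].
  pose U := chain_ideal DK0 D_total.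
  have subU K : D K -> ideal_set K `<=` ideal_set U by exact: sub_chain_set.
  have farU : far U.
    move=> w Ww; rewrite leNgt; apply/negP => /dist_lt[y Uy hy].
    have gap : 0 < d - rn (a - w - y) by rewrite subr_gt0.
    have [_ [K CK <-] [z Kz yz]] := Uy _ gap.
    have : dist (sval K) (a - w) < d; last by rewrite ltNge (proj2 (svalP K)).
    apply: le_lt_trans (dist_le _ Kz) _; rewrite -(subrKA y).
    by apply: le_lt_trans (rnD _ _) _; rewrite -ltrBrDl.
  have J0U : ideal_set J0 `<=` ideal_set U.
    by move=> x J0x; apply: (subU _ DK0); apply: (proj1 (svalP K0)).
  exists (exist _ U (conj J0U farU)) => K CK; apply/asboolP; apply: subU.
  by exists K.
exists J => //; split=> // K JK farK.
have J0K : ideal_set J0 `<=` ideal_set K by move=> x /J0J/JK.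
have := Jmax (exist _ K (conj J0K farK)).
by move=> /(_ (introT (asboolP _) JK)) /asboolP.
Qed.

Variables (J : ideal A) (s : A).
Hypotheses (s_sa : cstar s = s) (s_le1 : rn s <= 1).
Hypothesis s_centr : forall x, ideal_set J (s ** x - x ** s).

Local Notation H := (element_op s_sa s_le1).

Hypothesis J_max : maximal_far J.
Hypothesis W_glue : forall p w1 w2, (forall t, 0 <= t <= 1 -> 0 <= p.[t] <= 1) ->
  W w1 -> W w2 -> W (ract H p w1 + ract H (1 - p) w2).

(* If both side ideals were larger than [J], good approximants of [a] modulo
   each of them could be glued along a cutoff. *)
Lemma side_dichotomy l : 0 <= l <= 1 ->
  side_set J s_sa s_le1 l 1 `<=` ideal_set J \/
  side_set J s_sa s_le1 l (-1) `<=` ideal_set J.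
Proof.
move=> l01; apply: contrapT => /not_orP[n1 n2].
have s1 : 1 * 1 = 1 :> R by rewrite mulr1.
have s2 : -1 * -1 = 1 :> R by rewrite mulrNN mulr1.
have approx sg (sg2 : sg * sg = 1) : ~ (side_set J s_sa s_le1 l sg `<=` ideal_set J) ->
    exists w r j, [/\ W w, rn r < d, side_set J s_sa s_le1 l sg j & a - w = r + j].
  move=> nJ; have : ~ far (side s_sa s_le1 s_centr l01 sg2).
    by move=> /J_max.2 sub; apply: nJ; apply: sub => x; exact: sub_side_set.
  move=> /existsNP[w /not_implyP[Ww /negP]]; rewrite -ltNge => /dist_lt[j hj rj].
  by exists w, (a - w - j), j; split=> //; rewrite subrK.
have [w1 [r1 [j1 [W1 d1 h1 E1]]]] := approx _ s1 n1.
have [w2 [r2 [j2 [W2 d2 h2 E2]]]] := approx _ s2 n2.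
(* Both approximations are strictly better than [d]; the slack [d - m] pays for two cutoff errors of
   size [e]. *)
pose m := Num.max (rn r1) (rn r2).
have md : m < d by rewrite gt_max d1.
pose e := (d - m) / 4; have e0 : 0 < e by rewrite divr_gt0 // subr_gt0.
have [K1 hK1] := h1 _ e0; have [K2 hK2] := h2 _ e0.
pose k := maxn K1 K2; have {}hK1 := hK1 k (leq_maxl _ _); have {}hK2 := hK2 k (leq_maxr _ _).
pose q := cutoff l 1 k; have q01 t : 0 <= t <= 1 -> 0 <= q.[t] <= 1 by exact: cutoff01.
have qC : cutoff l (-1) k = 1 - q.
  rewrite /q /cutoff scaleN1r scale1r.
  apply: (@scalerI _ _ 2%:R); first by rewrite pnatr_eq0.
  rewrite [RHS]scalerBr !scalerA divff ?pnatr_eq0 // !scale1r scaler_nat mulr2n.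
  by rewrite opprD addrA addrK.
rewrite qC -/q in hK1 hK2.
have := J_max.1 _ (W_glue q01 W1 W2); apply/negP; rewrite -ltNge.
have -> : a - (ract H q w1 + ract H (1 - q) w2) =
    (ract H q r1 + ract H (1 - q) r2) + (ract H q j1 + ract H (1 - q) j2).
  rewrite addrACA -!ractDr -E1 -E2 !ractBr [RHS]addrACA -opprD; congr (_ - _).
  by rewrite -ractD subrKC ract1.
apply: le_lt_trans (distD _ _ _) _.
have b1 : dist J (ract H q r1 + ract H (1 - q) r2) <= m.
  by apply: dist_glue => //; rewrite le_max lexx ?orbT.
have b2 := distD J (ract H q j1) (ract H (1 - q) j2).
by rewrite /e in hK1 hK2; lra.
Qed.

(** [|X - l|] acts as [sg (X - l)] modulo [J]: the spectrum of [H] modulo [J] lies to the right of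
    [l] for [sg = 1], to the left for [sg = -1]. *)
Definition one_sided l sg := forall x k,
  dist J (ract H (shifted l * shifted_sgn l k - sg *: shifted l) x) <= 2 * eps R k * rn x.

Lemma one_sided_dichotomy l : 0 <= l <= 1 -> one_sided l 1 \/ one_sided l (-1).
Proof.
move=> l01; case: (side_dichotomy l01) => sub; [left|right] => x k.
  by apply: side_trivial => //; rewrite mulr1.
by apply: side_trivial => //; rewrite mulrNN mulr1.
Qed.

Lemma one_sided_end l sg : 0 <= l <= 1 ->
  (forall t, 0 <= t <= 1 -> sg * (t - l) = `|t - l|) -> one_sided l sg.
Proof.
move=> l01 h x k; apply: le_trans (dist_le_rn _ _) _.
apply: rbnd_sup => t t01; have [_] := sgnp_bound k (shifted_norm l01 t01).
rewrite !(shifted_horner, shifted_sgn_horner, hornerD, hornerN, hornerM, hornerZ).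
rewrite h // -normrN opprB => hk; apply: le_trans hk _.
by have := eps_gt0 R k; lra.
Qed.

(** A Dedekind cut: with [l0] the supremum of the [l] having the spectrum on their right, the
    spectrum of [H] modulo [J] reduces to [l0]. As [s] is [2 H - 1], it acts as [2 * l0 - 1]. *)
Lemma scalar_of_maximal : exists c : R, forall x, ideal_set J (s ** x - c%:C%C *: x).
Proof.
have zero01 : 0 <= (0 : R) <= 1 by rewrite lexx ler01.
have one01 : 0 <= (1 : R) <= 1 by rewrite lexx ler01.
have os0 : one_sided 0 1.
  by apply: one_sided_end => // t /andP[t0 _]; rewrite mul1r subr0 ger0_norm.
have os1 : one_sided 1 (-1).
  apply: one_sided_end => // t /andP[_ t1].
  by rewrite mulN1r ler0_norm // subr_le0.
pose S := [set l : R | 0 <= l <= 1 /\ one_sided l 1].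
have S0 : S 0 by [].
have supS : has_sup S by split; [exists 0|exists 1 => l [/andP[]]].
pose l0 := sup S.
have l0_ge0 : 0 <= l0 by apply: ub_le_sup => //; exact: supS.2.
have l0_le1 : l0 <= 1 by apply: ge_sup; [exists 0|move=> l [/andP[]]].
(* The 5 collects [2 e] from [D], [eps k] from [D], and half of [2 eps k] from each of [F] and [G],
   where [eps k < e]. *)
have key x e : 0 < e -> dist J (ract H (shifted l0) x) <= 5 * e * rn x.
  move=> e0.
  have [l1 [l1_01 os_l1] l1e] := sup_adherent e0 supS; rewrite -/l0 in l1e.
  have l1l0 : l1 <= l0 by apply: ub_le_sup => //; exact: supS.2.
  have [l2 [l2_01 os_l2 l0l2 l2e]] : exists l2, [/\ 0 <= l2 <= 1, one_sided l2 (-1),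
      l0 <= l2 & l2 <= l0 + e].
    have [le1|gt1] := leP (l0 + e) 1; last by exists 1; split=> //; exact: ltW.
    have h01 : 0 <= l0 + e <= 1 by rewrite le1 andbT addr_ge0 // ltW.
    exists (l0 + e); split=> //; last by rewrite lerDl ltW.
    case: (one_sided_dichotomy h01) => // os.
    have : l0 + e <= l0 by apply: ub_le_sup; [exact: supS.2|split].
    by rewrite gerDl leNgt e0.
  have [k ke] := eps_lt e0.
  pose F := shifted l1 * shifted_sgn l1 k - 1 *: shifted l1.
  pose G := shifted l2 * shifted_sgn l2 k - (-1) *: shifted l2.
  (* Up to [eps], [G / 2] is the positive part of [X - l2] and [F / 2] the negative part of
     [X - l1], so [D] is [X - l0] truncated to the short interval from [l1 - l0] to [l2 - l0]. *)
  pose D := shifted l0 - 2^-1 *: G + 2^-1 *: F.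
  have DE : shifted l0 = D + (2^-1 *: G - 2^-1 *: F).
    by rewrite /D; move: (2^-1 *: G) (2^-1 *: F) => g f; ring.
  have half : `|2^-1 : R| = 2^-1 by rewrite ger0_norm ?invr_ge0.
  have bD : rbnd H D (2 * e + eps R k).
    apply: rbnd_sup => t t01.
    have [_ h1] := sgnp_bound k (shifted_norm l1_01 t01).
    have [_ h2] := sgnp_bound k (shifted_norm l2_01 t01).
    rewrite !(shifted_horner, shifted_sgn_horner, hornerD, hornerN, hornerM, hornerZ).
    set u1 := (t - l1) * _ in h1 *; set u2 := (t - l2) * _ in h2 *.
    have := ler_norm u1; rewrite ler_norml in h1; rewrite ler_norml in h2.
    case/andP: h1 => h1 h1'; case/andP: h2 => h2 h2' _.
    rewrite ler_norml.
    by have [q1|q1] := lerP 0 (t - l1); have [q2|q2] := lerP 0 (t - l2);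
       rewrite ?(ger0_norm q1) ?(ltr0_norm q1) ?(ger0_norm q2) ?(ltr0_norm q2) in h1 h1' h2 h2';
       apply/andP; split; lra.
  rewrite DE ractD; apply: le_trans (distD _ _ _) _.
  have hD := le_trans (dist_le_rn J _) (bD x).
  have hF := os_l1 x k; have hG := os_l2 x k; rewrite -/F -/G in hF hG.
  rewrite ractB !ractZ; have hB := distB J (2^-1%:C%C *: ract H G x) (2^-1%:C%C *: ract H F x).
  have hG' := distZ J (2^-1%:C%C) (ract H G x); have hF' := distZ J (2^-1%:C%C) (ract H F x).
  rewrite Re_normC half in hG' hF'.
  have x0 := rn_ge0 x; have ek := eps_gt0 R k.
  have : eps R k * rn x <= e * rn x by rewrite ler_wpM2r // ltW.
  lra.
exists (2 * l0 - 1) => x.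
have : ideal_set J (ract H (shifted l0) x).
  apply: dist_eq0; apply/ler_addgt0Pr => e e0; rewrite add0r.
  have x1 : 0 < 5 * (rn x + 1) by rewrite mulr_gt0 // ltr_wpDl ?rn_ge0.
  have c0 := divr_gt0 e0 x1; set c := e / _ in c0.
  have cE : c * (5 * (rn x + 1)) = e by rewrite /c divfK // gt_eqF.
  by apply: le_trans (key x _ c0) _; lra.
move=> /(idealZ 2%:C%C); congr ideal_set.
rewrite -(ract_polyY s_sa s_le1 x) -(ractC H (2 * l0 - 1)) -ractZ -ractB; congr (ract _ _ _).
rewrite /shifted /polyY -!mul_polyC polyCB polyCM polyC1.
ring.
Qed.

End Far.

(** * Scalars modulo an ideal *)

Section ModuloIdeal.
Variables (R : realType) (A : cstarAlgType R).
Implicit Types (I J K M : ideal A) (x y z : A).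

(** Stated through products because [A/J] need not have an identity. *)
Definition acts_scalar J x (k : R[i]) := forall y, ideal_set J (x ** y - k *: y).

Definition central_mod J x := forall y, ideal_set J (x ** y - y ** x).

Lemma central_modD J x y : central_mod J x -> central_mod J y -> central_mod J (x + y).
Proof.
by move=> hx hy z; rewrite amulDl amulDr opprD addrACA; apply: idealD.
Qed.

Lemma central_modZ J k x : central_mod J x -> central_mod J (k *: x).
Proof. by move=> hx z; rewrite amulZl amulZr -scalerBr; apply: idealZ. Qed.

Lemma central_mod_cstar J x : central_mod J x -> central_mod J (cstar x).
Proof.
move=> hx z; rewrite -opprB; apply: idealN.
by rewrite -[X in ideal_set J X]cstarK; apply: ideal_cstar; rewrite cstarB !cstarM cstarK.
Qed.

Lemma central_modW J K x : ideal_set J `<=` ideal_set K -> central_mod J x -> central_mod K x.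
Proof. by move=> JK hx y; exact: JK. Qed.

Lemma centreD x y : centre A x -> centre A y -> centre A (x + y).
Proof. by move=> hx hy z; rewrite amulDl amulDr hx hy. Qed.

Lemma centreZ k x : centre A x -> centre A (k *: x).
Proof. by move=> hx z; rewrite amulZl amulZr hx. Qed.

Lemma centreM x y : centre A x -> centre A y -> centre A (x ** y).
Proof. by move=> hx hy z; rewrite -amulA hy amulA hx amulA. Qed.

Lemma centre0 : centre A 0.
Proof. by move=> z; rewrite amul0l amul0r. Qed.

Lemma centre_cstar x : centre A x -> centre A (cstar x).
Proof. by move=> hx z; rewrite -[z in LHS]cstarK -cstarM -hx cstarM cstarK. Qed.

Lemma centre_central_mod J x : centre A x -> central_mod J x.
Proof. by move=> hx y; rewrite hx subrr; exact: ideal0. Qed.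

Lemma centre_ract (s : A) (s_sa : cstar s = s) (s_le1 : rn s <= 1) p x :
  centre A s -> centre A x -> centre A (ract (element_op s_sa s_le1) p x).
Proof.
move=> hs hx; apply: (@ract_ind _ _ _ (centre A)) => //.
- exact: centreD.
- exact: centreZ.
- by move=> u hu; apply: centreZ; apply: centreD => //; exact: centreM.
Qed.

Lemma acts_scalarZ J x k c : acts_scalar J x k -> acts_scalar J (c *: x) (c * k).
Proof. by move=> h y; rewrite amulZl -scalerA -scalerBr; apply: idealZ. Qed.

Lemma acts_scalarD J x y k l : acts_scalar J x k -> acts_scalar J y l ->
  acts_scalar J (x + y) (k + l).
Proof. by move=> hx hy z; rewrite amulDl scalerDl opprD addrACA; apply: idealD. Qed.

Lemma acts_scalar0 J x : acts_scalar J x 0 -> ideal_set J x.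
Proof.
by move=> h; apply: ideal_faithful => y; have := h y; rewrite scale0r subr0.
Qed.

(* Splitting into real and imaginary parts reduces a scalarity statement on a
   selfadjoint subspace to selfadjoint contractions. *)
Lemma acts_scalar_complex J (P : A -> Prop) :
  (forall x y, P x -> P y -> P (x + y)) -> (forall k x, P x -> P (k *: x)) ->
  (forall x, P x -> P (cstar x)) ->
  (forall s, cstar s = s -> rn s <= 1 -> P s -> exists c : R, acts_scalar J s c%:C%C) ->
  forall x, P x -> exists k, acts_scalar J x k.
Proof.
move=> PD PZ Pstar h.
have hsa s : cstar s = s -> P s -> exists k, acts_scalar J s k.
  move=> s_sa Ps; pose c := rn s + 1; have c0 : 0 < c by rewrite ltr_wpDl ?rn_ge0.
  have [||l hl] := h (c^-1%:C%C *: s) _ _ (PZ _ _ Ps).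
  - by rewrite cstarZ s_sa; congr (_ *: _); exact: conjc_real.
  - by rewrite rnZr ger0_norm ?invr_ge0 ?(ltW c0) // mulrC ler_pdivrMr // mul1r lerDl.
  exists (c%:C%C * l%:C%C); have := acts_scalarZ c%:C%C hl.
  by rewrite scalerA -rmorphM divff ?gt_eqF // scale1r.
move=> x Px.
have [||k hk] := hsa (x + cstar x); first by rewrite cstarD cstarK addrC.
  by apply: PD => //; exact: Pstar.
have [||l hl] := hsa ('i *: (x - cstar x)).
- rewrite cstarZ cstarB cstarK conjCi scaleNr -scalerN opprB //.
- by apply: (PZ); apply: PD => //; rewrite -scaleN1r; apply: PZ; exact: Pstar.
exists (2%:R^-1 * k + - (2%:R^-1 * 'i) * l).
rewrite (_ : x = 2%:R^-1 *: (x + cstar x) + (- (2%:R^-1 * 'i)) *: ('i *: (x - cstar x))).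
  by apply: acts_scalarD; exact: acts_scalarZ.
have i2 : - (2%:R^-1 * 'i) * 'i = 2%:R^-1 :> R[i] by rewrite mulNr -mulrA -expr2 sqrCi mulrN1 opprK.
rewrite scalerA i2 -scalerDr.
rewrite addrACA subrr addr0 -mulr2n -[x *+ 2]scaler_nat scalerA mulVf ?pnatr_eq0 //.
by rewrite scale1r.
Qed.

(** Submultiplicativity, applied to an idempotent modulo [K]. Excluding an identity [e] thus means
    staying at distance at least 1 from it, which turns maximal far ideals into maximal ideals. *)
Lemma dist_unit_ge1 K e : ideal_set K (e ** e - e) -> ~ ideal_set K e -> 1 <= dist K e.
Proof.
move=> ee ne; have e0 : 0 < dist K e.
  by rewrite lt_neqAle dist_ge0 andbT eq_sym; apply/eqP => h; apply: ne; apply: dist_eq0; rewrite h.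
by rewrite -(ler_pM2r e0) mul1r -{1}(dist_congr ee) distM.
Qed.

Definition unit_mod M e := forall x, ideal_set M (e ** x - x) /\ ideal_set M (x ** e - x).

Lemma unit_mod_proper M e : unit_mod M e -> ideal_proper M -> ~ ideal_set M e.
Proof.
move=> ue pM Me; apply: pM; apply/seteqP; split=> // x _.
rewrite -[x](subKr (e ** x)); apply: idealB; first exact: idealMr.
exact: (ue x).1.
Qed.

Lemma unit_mod_identity M e : unit_mod M e -> is_identity (coset M e).
Proof.
move=> ue u; have [x <-] := coset_surj u.
split; rewrite -[LHS]cosetM; apply/cosetP; by case: (ue x).
Qed.

Lemma unit_mod_scalar M e a k : unit_mod M e -> ideal_set M (a - k *: e) -> scalar_mod M a k.
Proof.
move=> ue h; exists (coset M e); split; first exact: unit_mod_identity.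
by rewrite -[RHS]cosetZ; apply/cosetP.
Qed.

Lemma scalar_mod_unit M a k : scalar_mod M a k ->
  exists2 e, unit_mod M e & ideal_set M (a - k *: e).
Proof.
case=> u [hu ak]; have [e eu] := coset_surj u; exists e.
  move=> x; have [h1 h2] := hu (coset M x).
  by split; apply/cosetP; rewrite cosetM eu.
by apply/cosetP; rewrite cosetZ eu.
Qed.

Lemma centre_quotientP I a : centre (quotient I) (coset I a) <-> central_mod I a.
Proof.
split=> [h y|h u].
  by apply/cosetP; rewrite !cosetM; exact: (h (coset I y)).
have [y <-] := coset_surj u.
by rewrite -[LHS]cosetM -[RHS]cosetM; apply/cosetP.
Qed.

(* A maximal ideal keeping [b] at its distance from [J] makes every element
   central modulo [J] scalar, so [b] becomes a multiple of a unit. *)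
Lemma exists_Max_scalar J b : central_mod J b -> ~ ideal_set J b ->
  exists M e, [/\ Max M, ideal_set J `<=` ideal_set M, unit_mod M e,
    forall c, central_mod J c -> exists k, ideal_set M (c - k *: e) &
    exists2 k, k != 0 & ideal_set M (b - k *: e)].
Proof.
move=> cb nb; pose W := [set 0 : A].
have b0 : 0 < dist J b.
  by rewrite lt_neqAle dist_ge0 andbT eq_sym; apply/eqP => h; apply: nb; apply: dist_eq0; rewrite h.
have farW K x d : d <= dist K x -> far x W d K by move=> h _ ->; rewrite subr0.
have [J' JJ' J'max] := exists_maximal_far (farW J b _ (lexx _)).
have nb' : ~ ideal_set J' b.
  move=> h; have := J'max.1 0 erefl.
  by rewrite subr0 (dist_ideal h) leNgt b0.
have scal c : central_mod J' c -> exists k, acts_scalar J' c k.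
  apply: acts_scalar_complex => [x y|k x|x|s s_sa s1 cs].
  - exact: central_modD.
  - exact: central_modZ.
  - exact: central_mod_cstar.
  have [|l hl] := @scalar_of_maximal _ _ _ _ _ _ _ s_sa s1 cs J'max; last by exists l.
  by move=> p w1 w2 _ -> ->; rewrite !ract0r addr0.
have [k bk] := scal _ (central_modW JJ' cb).
have k0 : k != 0.
  by apply/eqP => k0; apply: nb'; apply: acts_scalar0; rewrite -k0.
pose e := k^-1 *: b.
have e1 : acts_scalar J' e 1 by have := acts_scalarZ k^-1 bk; rewrite mulVf.
have eJ' : unit_mod J' e.
  move=> x; split; first by have := e1 x; rewrite scale1r.
  have ce := central_modZ k^-1 (central_modW JJ' cb) x.
  rewrite -[X in ideal_set _ X](subrKA (e ** x)); apply: idealD.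
    by rewrite -opprB; exact: idealN.
  by have := e1 x; rewrite scale1r.
have ne : ~ ideal_set J' e.
  move=> h; apply: nb'; rewrite -[b](scalerKV k0); exact: idealZ.
(* A second maximality, now relative to the unit: the ideals above [J'] that are far from [e] are
   exactly the proper ones. *)
have far1 K : ideal_set J' `<=` ideal_set K -> ~ ideal_set K e -> far e W 1 K.
  move=> J'K nK; apply: farW; apply: dist_unit_ge1 => //.
  exact: J'K (eJ' e).1.
have [M J'M Mmax] := exists_maximal_far (far1 J' (fun x => id) ne).
have eM : unit_mod M e by move=> x; split; apply: J'M; case: (eJ' x).
have nM : ~ ideal_set M e.
  by move=> h; have := Mmax.1 0 erefl; rewrite subr0 (dist_ideal h) ler10.
have scalM c l : acts_scalar J' c l -> ideal_set M (c - l *: e).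
  move=> h; rewrite -[X in ideal_set _ X](subrKA (c ** e)); apply: idealD.
    by rewrite -opprB; apply: idealN; exact: (eM c).2.
  by apply: J'M.
exists M, e; split=> //.
- split; first by exists (coset M e); exact: unit_mod_identity.
  split; first by move=> h; apply: nM; rewrite h.
  move=> K pK MK; apply/seteqP; split=> //; apply: Mmax.2 => //.
  apply: far1 => [x /J'M/MK //|]; apply: unit_mod_proper pK.
  by move=> x; split; apply: MK; case: (eM x).
- by move=> x /JJ'/J'M.
- by move=> c /(central_modW JJ')/scal[l /scalM h]; exists l.
- by exists k => //; exact: scalM.
Qed.

End ModuloIdeal.

(** * Approximation by central elements *)

Section Main.
Variables (R : realType) (A : cstarAlgType R).
Implicit Types (I J K M : ideal A) (x y z : A).

Lemma ract_acts_scalar J s (s_sa : cstar s = s) (s_le1 : rn s <= 1) c p x :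
  acts_scalar J s c%:C%C ->
  ideal_set J (ract (element_op s_sa s_le1) p x - (p.[(1 + c) / 2])%:C%C *: x).
Proof.
move=> h; elim/poly_ind: p x => [|p l IH] x.
  by rewrite /ract rmorph0 act0 horner0 scale0r subrr; exact: ideal0.
rewrite ractD ractM ractX ractC hornerMXaddC rmorphD scalerDl /=.
rewrite opprD addrACA subrr addr0; set t := (1 + c) / 2.
set Hx := 2%:R^-1 *: (x + s ** x).
have Ht : ideal_set J (Hx - t%:C%C *: x).
  have -> : Hx - t%:C%C *: x = 2%:R^-1 *: (s ** x - c%:C%C *: x).
    rewrite /Hx /t rmorphM fmorphV rmorph_nat rmorphD rmorph1 mulrC -scalerA -scalerBr.
    by congr (_ *: _); rewrite scalerDl scale1r opprD addrACA subrr add0r.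
  exact: idealZ.
rewrite -[X in ideal_set _ X](subrKA (p.[t]%:C%C *: Hx)); apply: idealD; first exact: IH.
by rewrite rmorphM -scalerA -scalerBr; exact: idealZ.
Qed.

(* [no_obstruction I b] is invariant under [b |-> b - z - i] for [z] central
   and [i] in [I]; its failure is what produces the maximal ideals of [V1] or
   [V2]. *)
Definition no_obstruction I b := forall J, ideal_set I `<=` ideal_set J ->
  (forall z, centre A z -> exists k, acts_scalar J z k) ->
  exists2 z, centre A z & ideal_set J (b - z).

Lemma no_obstruction_sub I b z i : no_obstruction I b -> centre A z ->
  ideal_set I i -> no_obstruction I (b - z - i).
Proof.
move=> nb cz Ii J IJ sc; have [w cw Jw] := nb J IJ sc.
exists (w - z); first by apply: centreD => //; rewrite -scaleN1r; exact: centreZ.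
have -> : b - z - i - (w - z) = (b - w) - i.
  by rewrite opprB addrA [_ - i + z]addrAC subrK addrAC.
by apply: idealB => //; exact: IJ.
Qed.

(* The bound [rn u <= 1] is what allows norm control in [centre_approx], and
   hence the convergence of the series in [no_obstruction_mem]. *)
Lemma centre_near_unit J e d : centre A e -> acts_scalar J e 1 -> 0 < d ->
  exists u, [/\ centre A u, rn u <= 1 &
    exists2 c : R, acts_scalar J u c%:C%C & 1 - d <= c <= 1].
Proof.
move=> ce e1 d0; pose y := cstar e ** e.
have cy : centre A y by apply: centreM => //; exact: centre_cstar.
have y_sa : cstar y = y by rewrite cstarM cstarK.
have es1 x : ideal_set J (cstar e ** x - x).
  rewrite -[X in ideal_set _ X]cstarK; apply: ideal_cstar.
  by rewrite cstarB cstarM cstarK -ce; have := e1 (cstar x); rewrite scale1r.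
have y1 : acts_scalar J y 1.
  move=> x; rewrite scale1r -amulA -[X in ideal_set _ X](subrKA (e ** x)).
  by apply: idealD; [exact: es1|have := e1 x; rewrite scale1r].
pose c := rn y + 1; have c0 : 0 < c by rewrite ltr_wpDl ?rn_ge0.
have c1 : 1 <= c by rewrite lerDr rn_ge0.
pose s := c^-1%:C%C *: y.
have s_sa : cstar s = s by rewrite cstarZ y_sa; congr (_ *: _); exact: conjc_real.
have s1 : rn s <= 1.
  by rewrite rnZr ger0_norm ?invr_ge0 ?(ltW c0) // mulrC ler_pdivrMr // mul1r lerDl.
have sc : acts_scalar J s c^-1%:C%C.
  by have := acts_scalarZ c^-1%:C%C y1; rewrite mulr1.
have cs : centre A s by exact: centreZ.
pose H := element_op s_sa s1.
(* Modulo [J], [s] is the scalar [1 / c]; a bound [d / c] on [|2 t - 1|] times [damp] therefore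
   gives [damp <= d] there. *)
have [n hn] := damp_small (divr_gt0 d0 c0).
have [g gE] := one_sub_damp R n.
pose u := ract H (polyY R * g) s.
have uE x : u ** x = ract H (1 - damp R n) x.
  by rewrite -ract_amul -(ract_polyY s_sa s1 x) -ractM gE mulrA mulrC mulrA.
have u_le : rn u <= 1.
  have h : rbnd H (1 - damp R n) 1.
    apply: rbnd_sup => t /(damp01 n) /andP[h0 h1].
    by rewrite hornerD hornerN hornerC ger0_norm; lra.
  have [->|u0] := eqVneq (rn u) 0; first exact: ler01.
  have up : 0 < rn u by rewrite lt_neqAle eq_sym u0 rn_ge0.
  rewrite -(ler_pM2r up) mul1r -expr2 -rn_mulcstar uE.
  by apply: le_trans (h _) _; rewrite mul1r rn_cstar.
pose t := (1 + c^-1) / 2.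
have ci : 0 < c^-1 <= 1 by rewrite invr_gt0 c0 invf_le1.
have t01 : 0 <= t <= 1 by rewrite /t; case/andP: ci => ci0 ci1; apply/andP; split; lra.
exists u; split=> //; first by exact: centre_ract.
exists (1 - damp R n).[t].
  by move=> x; rewrite uE; exact: ract_acts_scalar.
rewrite hornerD hornerN hornerC.
have /andP[h0 h1] := damp01 n t01; have := hn _ t01.
have -> : 2 * t - 1 = c^-1 by rewrite /t; field; rewrite gt_eqF.
rewrite ger0_norm; last by case/andP: ci => /ltW.
rewrite ler_pdivlMr // mulrAC mulVf ?gt_eqF // mul1r => hd.
by apply/andP; split; lra.
Qed.

(** Otherwise an ideal [J] maximal among those far from [b] relative to the ball makes [Z(A)]
    scalar, and [b] agrees modulo [J] with a central [z0] acting as [k0]. The norm of [z0] may be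
    too large, but [|k0|] is at most the norm of [b], so [k0 *: u] with [u] a near unit lies in the
    ball and too close to [b]. *)
Lemma centre_approx I b d : no_obstruction I b -> 0 < d ->
  exists2 z, centre A z & rn z <= rn b /\ dist I (b - z) < d.
Proof.
move=> nb d0; apply: contrapT => hN.
pose W := [set z | centre A z /\ rn z <= rn b].
have farI : far b W d I.
  move=> w [cw wb]; rewrite leNgt; apply/negP => h; apply: hN.
  by exists w.
have [J IJ Jmax] := exists_maximal_far farI.
have farJ z : centre A z -> rn z <= rn b -> d <= dist J (b - z).
  by move=> cz zb; apply: Jmax.1.
have sc z : centre A z -> exists k, acts_scalar J z k.
  apply: acts_scalar_complex => [x y|k x|x|s s_sa s1 cs].
  - exact: centreD.
  - exact: centreZ.
  - exact: centre_cstar.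
  have [|l hl] := @scalar_of_maximal _ _ _ _ _ _ _ s_sa s1 (centre_central_mod J cs) Jmax;
    last by exists l.
  move=> p w1 w2 p01 [c1 w1b] [c2 w2b]; split.
    by apply: centreD; exact: centre_ract.
  rewrite -dist_zero_ideal; apply: dist_glue => //.
  exact: centre_central_mod.
have [z0 cz0 Jz0] := nb J IJ sc; have [k0 hk0] := sc _ cz0.
have nJb : ~ ideal_set J b.
  move=> Jb; have := farJ 0 (@centre0 R A); rewrite rn0 rn_ge0 subr0 (dist_ideal Jb).
  by move=> /(_ isT); rewrite leNgt d0.
have k0_neq0 : k0 != 0.
  apply/eqP => k00; apply: nJb; rewrite -[b](subrK z0); apply: idealD => //.
  by apply: acts_scalar0; rewrite -k00.
pose e := k0^-1 *: z0.
have ce : centre A e by exact: centreZ.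
have z0E : z0 = k0 *: e by rewrite scalerKV.
have e1 : acts_scalar J e 1 by have := acts_scalarZ k0^-1 hk0; rewrite mulVf.
have ne : ~ ideal_set J e.
  move=> Je; apply: nJb; rewrite -[b](subrK z0); apply: idealD => //.
  by rewrite z0E; exact: idealZ.
have de : 1 <= dist J e.
  by apply: dist_unit_ge1 => //; have := e1 e; rewrite scale1r.
pose nk := complex.Re `|k0|.
have nk_ge0 : 0 <= nk by exact: Re_norm_ge0.
have nk_le : nk <= rn b.
  apply: le_trans (dist_le_rn J b); rewrite (dist_congr Jz0).
  have h := distZ J k0^-1 z0; rewrite -/e normfV in h.
  have nk0 : 0 < nk.
    rewrite lt_neqAle nk_ge0 andbT eq_sym; apply/eqP => nk0.
    move: k0_neq0; rewrite -normr_eq0 -(RRe_real (_ : `|k0| \is Num.real)) ?ger0_real //.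
    by rewrite -/nk nk0 eqxx.
  have nkV : complex.Re `|k0|^-1 = nk^-1.
    rewrite -[`|k0|](RRe_real (_ : `|k0| \is Num.real)) ?ger0_real // -/nk.
    by rewrite -fmorphV.
  rewrite nkV in h; have := le_trans de h.
  by rewrite mulrC ler_pdivlMr // mul1r.
(* Chosen so that [|k0|] times the defect [1 - c] times the norm of [e] is below [d]; the added 1
   avoids division by zero. *)
have K0 : 0 < (nk * rn e + 1) by rewrite ltr_wpDl // mulr_ge0 ?rn_ge0.
have [u [cu u1 [c uc /andP[c1 c2]]]] := centre_near_unit ce e1 (divr_gt0 d0 K0).
have wb : rn (k0 *: u) <= rn b.
  by rewrite rnZ -/nk (le_trans _ nk_le) // ler_piMr.
have := farJ _ (centreZ k0 cu) wb; apply/negP; rewrite -ltNge.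
have -> : dist J (b - k0 *: u) = dist J (k0 *: ((1 - c)%:C%C *: e)).
  apply: dist_congr.
  have -> : b - k0 *: u - k0 *: ((1 - c)%:C%C *: e) =
      (b - z0) + k0 *: ((u ** e - u) - (u ** e - c%:C%C *: e)).
    rewrite z0E rmorphB rmorph1 scalerBl scale1r opprB [u ** e - u + _]addrC subrKA.
    by rewrite !scalerBr opprB addrACA [RHS]addrACA [- _ - _]addrC.
  apply: idealD => //; apply: idealZ; apply: idealB; last exact: uc.
  by rewrite cu; have := e1 u; rewrite scale1r.
apply: le_lt_trans (distZ _ _ _) _; rewrite -/nk.
have h2 := distZ J (1 - c)%:C%C e; rewrite Re_normC ger0_norm ?subr_ge0 // in h2.
apply: le_lt_trans (ler_wpM2l nk_ge0 h2) _.
have h3 := dist_le_rn J e; have h4 : 1 - c <= d / (nk * rn e + 1) by lra.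
rewrite ler_pdivlMr // in h4; have e0 := rn_ge0 e; have c3 : 0 <= 1 - c by rewrite subr_ge0.
have h5 : nk * ((1 - c) * dist J e) <= nk * ((1 - c) * rn e).
  by rewrite !ler_wpM2l.
have [c4|c4] := eqVneq c 1; first by move: h5; rewrite c4 subrr !mul0r mulr0 => /le_lt_trans ->.
have c5 : 0 < 1 - c by rewrite subr_gt0 lt_neqAle c4.
by lra.
Qed.

(** Successive approximation: the remainders [b n] are halved at each step and bound the central
    corrections, whose sum converges in [Z(A)]; what is left of [a] is a limit of elements of
    [I]. *)
Lemma no_obstruction_mem I a : no_obstruction I a ->
  exists2 z, centre A z & ideal_set I (a - z).
Proof.
move=> na; pose C := rn a + 1; have C0 : 0 < C by rewrite ltr_wpDl ?rn_ge0.
pose dl n : R := C / 2 ^+ n; have dl0 n : 0 < dl n by rewrite divr_gt0 ?exprn_gt0.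
have dlS n : dl n = dl n.+1 + dl n.+1.
  by rewrite /dl exprS; field; rewrite expf_neq0 // pnatr_eq0.
have step (bn : A * nat) : exists zi : A * A, no_obstruction I bn.1 ->
    [/\ centre A zi.1, ideal_set I zi.2, rn zi.1 <= rn bn.1 & rn (bn.1 - zi.1 - zi.2) <= dl bn.2.+1].
  have [nb|nb] := pselect (no_obstruction I bn.1); last by exists 0.
  have [z cz [zb /dist_lt[i Ii hi]]] := centre_approx nb (dl0 bn.2.+1).
  by exists (z, i) => _; split=> //; exact: ltW.
have [F hF] := choice step.
pose b := fix b n : A := if n is n'.+1 then b n' - (F (b n', n')).1 - (F (b n', n')).2 else a.
pose zz n := (F (b n, n)).1; pose ii n := (F (b n, n)).2.
have bS n : b n.+1 = b n - zz n - ii n by [].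
have nb n : no_obstruction I (b n).
  elim: n => [//|n IH]; rewrite bS; have [cz Ii _ _] := hF (b n, n) IH.
  exact: no_obstruction_sub.
have cz n : centre A (zz n) by have [] := hF (b n, n) (nb n).
have Ii n : ideal_set I (ii n) by have [] := hF (b n, n) (nb n).
have bn n : rn (b n) <= dl n.
  case: n => [|n]; first by rewrite /dl expr0 divr1 lerDl.
  by rewrite bS; have [] := hF (b n, n) (nb n).
have zn n : rn (zz n) <= dl n by have [_ _ h _] := hF (b n, n) (nb n); exact: le_trans (bn n).
pose S n := \sum_(k < n) zz k.
have cS n : centre A (S n).
  by rewrite /S; elim/big_ind: _ => // [|x y]; [exact: centre0|exact: centreD].
have S_cauchy m n : (m <= n)%N -> rn (S n - S m) <= 2 * dl m - 2 * dl n.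
  move=> /subnKC <-; elim: (n - m)%N => [|k IH]; first by rewrite addn0 !subrr rn0.
  rewrite addnS /S big_ord_recr /= -/(S _) addrAC; apply: le_trans (rnD _ _) _.
  by have := zn (m + k)%N; have := dlS (m + k)%N; lra.
have [||z hz] := @complete_rn _ A S (fun n => 2 * dl n).
- by move=> m n mn; have := S_cauchy _ _ mn; have := dl0 n; lra.
- move=> e e0; exists (Num.bound (2 * C / e)); set N := Num.bound _.
  have hN : 2 * C / e < N%:R by rewrite archi_boundP // divr_ge0 ?mulr_ge0 // ltW.
  have N2 : N%:R <= 2 ^+ N :> R by rewrite -natrX ler_nat ltnW // ltn_expl.
  rewrite /dl mulrA ltr_pdivrMr ?exprn_gt0 // [e * _]mulrC -ltr_pdivrMr //.
  exact: lt_le_trans N2.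
have small e : 0 < e -> exists n, dl n < e.
  move=> e0; exists (Num.bound (C / e)); set N := Num.bound _.
  have hN : C / e < N%:R by rewrite archi_boundP // divr_ge0 // ltW.
  have N2 : N%:R <= 2 ^+ N :> R by rewrite -natrX ler_nat ltnW // ltn_expl.
  rewrite /dl ltr_pdivrMr ?exprn_gt0 // mulrC -ltr_pdivrMr //.
  exact: lt_le_trans N2.
have bSE n : ideal_set I (a - S n - b n).
  elim: n => [|n IH]; first by rewrite /S big_ord0 subr0 subrr; exact: ideal0.
  rewrite bS /S big_ord_recr /= -/(S n).
  have -> : a - (S n + zz n) - (b n - zz n - ii n) = (a - S n - b n) + ii n.
    by rewrite opprD !opprB !addrA [_ - zz n + ii n]addrAC subrK addrAC.
  exact: idealD.
exists z.
  move=> x; apply/eqP; rewrite -subr_eq0; apply/eqP/rn_eq0/eqP; rewrite eq_le rn_ge0 andbT.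
  apply/ler_addgt0Pr => e e0; rewrite add0r.
  have x1 : 0 < 4 * rn x + 1 by rewrite ltr_wpDl // mulr_ge0 ?rn_ge0.
  have [n] := small _ (divr_gt0 e0 x1); rewrite ltr_pdivlMr // => hn.
  have -> : z ** x - x ** z = (z - S n) ** x - x ** (z - S n).
    by rewrite amulBl amulBr (cS n x) opprB addrA subrK.
  apply: le_trans (rnB _ _) _.
  have h1 := rnM (z - S n) x; have h2 := rnM x (z - S n); have h3 := hz n.
  have x0 := rn_ge0 x; have d0 := dl0 n; nra.
apply: dist_eq0; apply/ler_addgt0Pr => e e0; rewrite add0r.
have e3 : 0 < e / 3 by rewrite divr_gt0.
have [n hn] := small _ e3.
have -> : a - z = (a - S n - b n) + (b n - (z - S n)).
  by rewrite addrA subrK opprB addrA subrK.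
apply: le_trans (distD _ _ _) _; rewrite (dist_ideal (bSE n)) add0r.
apply: le_trans (dist_le_rn _ _) _; apply: le_trans (rnB _ _) _.
have h1 := bn n; have h2 := hz n; lra.
Qed.

End Main.

(** * The theorem *)

Section Witnesses.
Variables (R : realType) (A : cstarAlgType R).
Implicit Types (I J K M : ideal A) (a x y z e : A).

Lemma central_mod_scalar M a k : scalar_mod M a k -> central_mod M a.
Proof.
move=> [u [hu au]]; apply/centre_quotientP; rewrite au => v.
by rewrite amulZl amulZr (hu v).1 (hu v).2.
Qed.

(** A decomposition [a = z + i] would put [a], and hence the identity modulo [M], into [M]. *)
Lemma V1_sub_V a : V1 A a -> V A a.
Proof.
move=> [M [MaxM ZM [k [k0 sk]]]] /= CQa.
have [e ue ae] := scalar_mod_unit sk.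
have ca := central_mod_scalar sk.
have [z cz [i Mi zi]] := CQa M ((centre_quotientP M a).2 ca).
apply: (unit_mod_proper ue MaxM.2.1).
rewrite -[e](scalerK k0); apply: idealZ; rewrite -[k *: e](subKr a).
apply: idealB => //; rewrite -zi; apply: idealD => //; exact: ZM.
Qed.

(** If [a = z + i] modulo the intersection, [z] acts as [k1] modulo [M1] and as [k2] modulo [M2].
    For central [w] the element [z ** w - k2 *: w] is central, so it passes from [M2] to [M1], and
    [(k2 - k1) *: w] falls into [M1]. *)
Lemma V2_sub_V a : V2 A a -> V A a.
Proof.
move=> [M1 [M2 [k1 [k2 [[Max1 Max2] k12 [Z1 Z2] ZE [sc1 sc2]]]]]] CQa.
pose I12 : set A := ideal_set M1 `&` ideal_set M2.
have ID x y : I12 x -> I12 y -> I12 (x + y).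
  by move=> [x1 x2] [y1 y2]; split; exact: idealD.
have IZ k x : I12 x -> I12 (k *: x) by move=> [x1 x2]; split; exact: idealZ.
have IMl x y : I12 y -> I12 (x ** y) by move=> [x1 x2]; split; exact: idealMl.
have IMr x y : I12 x -> I12 (x ** y) by move=> [x1 x2]; split; exact: idealMr.
pose I : ideal A := Ideal (conj (ideal0 M1) (ideal0 M2)) ID IZ IMl IMr
  (closedI (@ideal_closed _ _ M1) (@ideal_closed _ _ M2)).
have ca : central_mod I a.
  by move=> x; split; [exact: central_mod_scalar sc1 x|exact: central_mod_scalar sc2 x].
have [z cz [i [Mi1 Mi2] zi]] := CQa I ((centre_quotientP I a).2 ca).
have zk M k w : ideal_set M i -> scalar_mod M a k -> ideal_set M (z ** w - k *: w).
  move=> Mi /scalar_mod_unit[e ue ae].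
  have -> : z ** w - k *: w = (a - k *: e) ** w - i ** w + k *: (e ** w - w).
    by rewrite -zi amulBl amulDl amulZl scalerBr [_ - i ** w]addrAC addrK subrKA.
  by apply: idealD; [apply: idealB; exact: idealMr|apply: idealZ; exact: (ue w).1].
apply: Z1 => w cw.
have mem k : ideal_set M1 (z ** w - k *: w) <-> ideal_set M2 (z ** w - k *: w).
  have cv : centre A (z ** w - k *: w).
    by apply: centreD; [exact: centreM|rewrite -scaleNr; exact: centreZ].
  have E := congr1 (fun S : set A => S (z ** w - k *: w)) ZE; rewrite /setI /= in E.
  split=> h; first by have [] : (ideal_set M2 `&` centre A) (z ** w - k *: w) by rewrite /setI /= -E.
  by have [] : (ideal_set M1 `&` centre A) (z ** w - k *: w) by rewrite /setI /= E.
have h1 := zk _ _ w Mi1 sc1; have h2 := (mem k2).2 (zk _ _ w Mi2 sc2).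
have kn : k2 - k1 != 0 by rewrite subr_eq0 eq_sym.
rewrite -[w](scalerK kn); apply: idealZ.
have -> : (k2 - k1) *: w = (z ** w - k1 *: w) - (z ** w - k2 *: w).
  by rewrite scalerBl opprB [RHS]addrC subrKA.
exact: idealB.
Qed.

(** When [Z(A)] is not inside [J], it contains an identity [e] modulo [J]. [M1] comes from [e] and
    gives [a] the scalar [l1]; [M2] comes from [a - l1 *: e], which is outside [J], so its scalar
    there differs by [k != 0]. *)
Lemma V_sub a : V A a -> V1 A a \/ V2 A a.
Proof.
move=> nCQ; have [I /not_implyP[cI nI]] := (existsNP _).2 nCQ.
have cIa := (centre_quotientP I a).1 cI.
have : ~ no_obstruction I a.
  move=> /no_obstruction_mem[z cz Iz]; apply: nI; exists z => //.
  by exists (a - z) => //; rewrite addrC subrK.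
move=> /existsNP[J /not_implyP[IJ /not_implyP[sc nJ]]].
have naJ z : centre A z -> ~ ideal_set J (a - z).
  by move=> cz Jz; apply: nJ; exists z.
have ca : central_mod J a := central_modW IJ cIa.
have [ZJ|/existsNP[z0 /not_implyP[cz0 nz0]]] := pselect (forall z, centre A z -> ideal_set J z).
  have [|M [e [MaxM JM ue _ [k k0 ak]]]] := exists_Max_scalar ca.
    by move=> Ja; apply: (naJ 0 (@centre0 R A)); rewrite subr0.
  left; exists M; split=> // [z /ZJ/JM //|]; exists k; split=> //.
  exact: unit_mod_scalar ak.
right; have [k0 hk0] := sc _ cz0.
have k0_neq0 : k0 != 0.
  by apply/eqP => k00; apply: nz0; apply: acts_scalar0; rewrite -k00.
pose e := k0^-1 *: z0.
have ce : centre A e by exact: centreZ.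
have e1 x : ideal_set J (e ** x - x).
  by have := acts_scalarZ k0^-1 hk0 x; rewrite mulVf // scale1r.
have ne : ~ ideal_set J e.
  by move=> Je; apply: nz0; rewrite -[z0](scalerKV k0_neq0); exact: idealZ.
have unit_e M f : ideal_set J `<=` ideal_set M -> unit_mod M f -> unit_mod M e.
  by move=> JM uf x; rewrite -(ce x); split; apply: JM.
have swap M f c k : ideal_set J `<=` ideal_set M -> unit_mod M f ->
    ideal_set M (c - k *: f) -> ideal_set M (c - k *: e).
  move=> JM uf ck; rewrite -[X in ideal_set _ X](subrKA (k *: f)); apply: idealD => //.
  rewrite -scalerBr; apply: idealZ.
  rewrite -[X in ideal_set _ X](subrKA (e ** f)); apply: idealD.
    by rewrite -opprB; apply: idealN; apply: JM.
  exact: (uf e).2.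
have [M1 [e1' [Max1 JM1 u1 scal1 _]]] := exists_Max_scalar (centre_central_mod J ce) ne.
have [l1 /(swap _ _ _ _ JM1 u1) al1] := scal1 _ ca.
have nb : ~ ideal_set J (a - l1 *: e) by apply: naJ; exact: centreZ.
have cb : central_mod J (a - l1 *: e).
  apply: central_modD => //; rewrite -scaleNr; apply: central_modZ.
  exact: centre_central_mod.
have [M2 [e2 [Max2 JM2 u2 _ [k kn /(swap _ _ _ _ JM2 u2) ak]]]] := exists_Max_scalar cb nb.
have ue1 := unit_e _ _ JM1 u1; have ue2 := unit_e _ _ JM2 u2.
have ne1 := unit_mod_proper ue1 Max1.2.1; have ne2 := unit_mod_proper ue2 Max2.2.1.
(* Both maximal ideals meet [Z(A)] exactly in the trace of [J]: a central element outside [J] is a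
   non-zero multiple of [e] modulo [J], and [e] is not in [M]. *)
have sub M z : ideal_set J `<=` ideal_set M -> ~ ideal_set M e ->
    centre A z -> ideal_set M z -> ideal_set J z.
  move=> JM nM cz Mz; have [c hc] := sc _ cz.
  have Jc : ideal_set J (z - c *: e).
    rewrite -[X in ideal_set _ X](subrKA (z ** e)); apply: idealD; last exact: hc.
    by rewrite -opprB; apply: idealN; rewrite cz; exact: e1.
  have [c0|c0] := eqVneq c 0; first by move: Jc; rewrite c0 scale0r subr0.
  case: nM; rewrite -[e](scalerK c0); apply: idealZ.
  by rewrite -[c *: e](subKr z); apply: idealB => //; exact: JM.
exists M1, M2, l1, (l1 + k); split.
- by [].
- by rewrite -subr_eq0 opprD addrA subrr add0r oppr_eq0.
- by split=> h; [apply: ne1|apply: ne2]; exact: h.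
- by apply/seteqP; split=> z [Mz cz]; split=> //; [apply: JM2|apply: JM1];
    [apply: (sub M1)|apply: (sub M2)].
split; first exact: unit_mod_scalar al1.
by apply: unit_mod_scalar ue2 _; rewrite scalerDl opprD addrA.
Qed.

End Witnesses.

Theorem theorem4p8 (R : realType) (A : cstarAlgType R) :
  V A = V1 A `|` V2 A.
Proof.
apply/seteqP; split=> a; first exact: V_sub.
by case; [exact: V1_sub_V|exact: V2_sub_V].
Qed.
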